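(* The sharp $\mathcal{S}^*_{\rho}$-radii for the classes $\mathcal{S}^*_{L}, \mathcal{S}^*_{RL}, \mathcal{S}^*_{C}, \mathcal{S}^*_{e}, \Delta^*$ and $\mathcal{BS}^*(\alpha)$ are: (i) $R_{\mathcal{S}^*_{\rho}}(\mathcal{S}^*_{L}) = \sinh^{-1}(1)(2-\sinh^{-1}(1)) \approx 0.985928$. (ii) $R_{\mathcal{S}^*_{\rho}}(\mathcal{S}^*_{RL}) = \dfrac{\left(2+(1+\sqrt{2})\sinh^{-1}(1)\right)\sinh^{-1}(1)}{5-3\sqrt{2} + \left(4(\sqrt{2}-1)+2\sinh^{-1}(1)\right)\sinh^{-1}(1)} \approx 0.964694$. (iii) $R_{\mathcal{S}^*_{\rho}}(\mathcal{S}^*_{C}) = \dfrac{1}{2}\left(\sqrt{2\left(2+3\sinh^{-1}(1)\right)}-2\right) \approx 0.523831$. (iv) $R_{\mathcal{S}^*_{\rho}}(\mathcal{S}^*_{e}) = \ln(1+\sinh^{-1}(1)) \approx 0.632002$. (v) $R_{\mathcal{S}^*_{\rho}}(\Delta^* ) = \dfrac{\sinh^{-1}(1)(2+\sinh^{-1}(1))}{2(1+\sinh^{-1}(1))} \approx 0.674924$. (vi) $R_{\mathcal{S}^*_{\rho}}(\mathcal{BS}^*(\alpha)) = \dfrac{-1+\sqrt{1+\alpha\left(2\sinh^{-1}(1)\right)^2}}{2\alpha\sinh^{-1}(1)}$ for $\alpha \in [0,1]$, where for $\alpha=0$ the right-hand side is read as $\sinh^{-1}(1)$.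
   Context: $\mathbb{D}=\{z\in\mathbb{C}:|z|<1\}$. $\mathcal{A}$ is the class of analytic functions $f$ on $\mathbb{D}$ with $f(z)=z+a_2z^2+a_3z^3+\cdots$; $\mathcal{S}\subset\mathcal{A}$ is the subclass of univalent functions. For analytic $g,h$ on $\mathbb{D}$, $g\prec h$ (subordination) means $g=h\circ\omega$ for some analytic $\omega$ on $\mathbb{D}$ with $\omega(0)=0$ and $|\omega(z)|\le|z|$. $\sinh^{-1}(z)=\ln(z+\sqrt{1+z^2})$ is the principal branch (analytic in $\mathbb{D}$, $\sinh^{-1}(0)=0$); square roots are principal. $\mathcal{S}^*_{\rho}=\{f\in\mathcal{A}: zf'(z)/f(z)\prec 1+\sinh^{-1}(z)\}$. Write $\mathcal{S}^*(\psi)=\{f\in\mathcal{S}: zf'(z)/f(z)\prec\psi(z)\}$. Then $\mathcal{S}^*_L=\mathcal{S}^*(\sqrt{1+z})$; $\mathcal{S}^*_{RL}=\mathcal{S}^*(\psi)$ with $\psi(z)=\sqrt2-(\sqrt2-1)\sqrt{\frac{1-z}{1+2(\sqrt2-1)z}}$; $\mathcal{S}^*_C=\mathcal{S}^*(1+4z/3+2z^2/3)$; $\mathcal{S}^*_e=\mathcal{S}^*(e^z)$; $\Delta^*=\mathcal{S}^*(z+\sqrt{1+z^2})$; and, for $\alpha\in[0,1]$, $\mathcal{BS}^*(\alpha)=\mathcal{S}^*(1+z/(1-\alpha z^2))$. For $G_1,G_2\subset\mathcal{A}$, the $G_1$-radius $R_{G_1}(G_2)$ of $G_2$ is the greatest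 number $r_0\in(0,1]$ such that for every $g\in G_2$ and every $0<r\le r_0$ the function $z\mapsto r^{-1}g(rz)$ belongs to $G_1$.
   Formalization: In (vi), BS*(α) is taken as all f in 𝒜 (univalence not required) with zf'(z)/f(z) ≺ 1+z/(1−αz²); if f must lie in 𝒮, the stated radius is not sharp for any α in (0,1], since the extremal function has a critical point in the disk. *)

(* Defs.v *)
From Stdlib Require Export Reals.
From Coquelicot Require Export Coquelicot.

Open Scope R_scope.

Definition in_disk (z : C) : Prop := Cmod z < 1.

Definition analytic_disk (f : C -> C) : Prop :=
  forall z : C, in_disk z -> @ex_derive C_AbsRing C_NormedModule f z.

Definition univalent_disk (f : C -> C) : Prop :=
  forall z w : C, in_disk z -> in_disk w -> f z = f w -> z = w.

(* Only the values on the open unit disk matter: a total function C -> C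
   stands for its restriction to the disk, here and below. *)
Definition class_A (f : C -> C) : Prop :=
  analytic_disk f /\ f (RtoC 0) = RtoC 0 /\ C_derive f (RtoC 0) = RtoC 1.

Definition class_S (f : C -> C) : Prop := class_A f /\ univalent_disk f.

Definition subordinate (g h : C -> C) : Prop :=
  exists omega : C -> C,
    analytic_disk omega /\
    omega (RtoC 0) = RtoC 0 /\
    (forall z : C, in_disk z -> Cmod (omega z) <= Cmod z) /\
    (forall z : C, in_disk z -> g z = h (omega z)).

(* z f'(z) / f(z), with its removable singularity at 0 filled in: for f in
   class_A the quotient tends to 1 there. *)
Definition log_quotient (f : C -> C) (z : C) : C :=
  if Ceq_dec z (RtoC 0) then RtoC 1 else (z * C_derive f z / f z)%C.

(* Division by zero is total in Rocq, so the absence of poles, implicit in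
   "zf'/f is subordinate to psi", is spelled out. *)
Definition quotient_subordinate (psi : C -> C) (f : C -> C) : Prop :=
  (forall z : C, in_disk z -> z <> RtoC 0 -> f z <> RtoC 0) /\
  subordinate (log_quotient f) psi.

(* Principal argument, in (-PI, PI]: by the half-angle formula,
   tan (Arg z / 2) = Im z / (|z| + Re z) off the closed negative real axis. *)
Definition Carg (z : C) : R :=
  if Rlt_dec 0 (Cmod z + Re z) then 2 * atan (Im z / (Cmod z + Re z)) else PI.

Definition Clog (z : C) : C := (ln (Cmod z), Carg z).

Definition Cexp (z : C) : C := (exp (Re z) * cos (Im z), exp (Re z) * sin (Im z)).

(* Principal square root: Re >= 0, and Im >= 0 on the negative real axis. *)
Definition Csqrt (z : C) : C :=
  (sqrt ((Cmod z + Re z) / 2),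
   (if Rlt_dec (Im z) 0 then -1 else 1) * sqrt ((Cmod z - Re z) / 2)).

Definition Casinh (z : C) : C := Clog (z + Csqrt (1 + z * z))%C.

Definition psi_rho (z : C) : C := (1 + Casinh z)%C.

Definition psi_L (z : C) : C := Csqrt (1 + z)%C.

Definition psi_RL (z : C) : C :=
  (RtoC (sqrt 2)
   - RtoC (sqrt 2 - 1) * Csqrt ((1 - z) / (1 + RtoC (2 * (sqrt 2 - 1)) * z)))%C.

Definition psi_C (z : C) : C := (1 + 4 * z / 3 + 2 * (z * z) / 3)%C.

Definition psi_e (z : C) : C := Cexp z.

Definition psi_Delta (z : C) : C := (z + Csqrt (1 + z * z))%C.

Definition psi_BS (alpha : R) (z : C) : C := (1 + z / (1 - RtoC alpha * (z * z)))%C.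

Definition S_star (psi : C -> C) (f : C -> C) : Prop :=
  class_S f /\ quotient_subordinate psi f.

Definition S_star_rho (f : C -> C) : Prop :=
  class_A f /\ quotient_subordinate psi_rho f.

Definition S_star_L : (C -> C) -> Prop := S_star psi_L.
Definition S_star_RL : (C -> C) -> Prop := S_star psi_RL.
Definition S_star_C : (C -> C) -> Prop := S_star psi_C.
Definition S_star_e : (C -> C) -> Prop := S_star psi_e.
Definition Delta_star : (C -> C) -> Prop := S_star psi_Delta.

(* The ambient class is class_A, as in the original definition of BS(alpha) by
   Kargar, Ebadian and Sokol, and not class_S: for 0 < alpha <= 1 psi_BS alpha
   has the zero -2 / (1 + sqrt (1 + 4 alpha)) in the disk, so the extremal
   function, with zf'/f = psi_BS alpha, has a critical point and is not
   univalent.  For the five classes above the choice is immaterial, since there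
   Re psi > 0 on the disk and zf'/f subordinate to psi implies univalence. *)
Definition BS_star (alpha : R) (f : C -> C) : Prop :=
  class_A f /\ quotient_subordinate (psi_BS alpha) f.

Definition dilate (r : R) (g : C -> C) (z : C) : C := (/ RtoC r * g (RtoC r * z))%C.

Definition radius_property (G1 G2 : (C -> C) -> Prop) (r0 : R) : Prop :=
  forall g : C -> C, G2 g -> forall r : R, 0 < r <= r0 -> G1 (dilate r g).

Definition is_class_radius (G1 G2 : (C -> C) -> Prop) (R0 : R) : Prop :=
  (0 < R0 <= 1 /\ radius_property G1 G2 R0) /\
  (forall r0 : R, 0 < r0 <= 1 -> radius_property G1 G2 r0 -> r0 <= R0).

(* x is a, rounded to six decimals. *)
Definition approx6 (x a : R) : Prop := Rabs (x - a) <= / 2 * / 10 ^ 6.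

(* Main.v *)
(* The radius R0 of each class is the number where the extremal value |psi(x) - 1| over
   |x| = R0 reaches a = arcsinh 1.  For the inclusion we show |psi z - 1| <= (a / R0) |z| on
   |z| <= R0.  As |sinh u| <= sinh |u| and sinh is convex with sinh a = 1, the function
   sinh (psi (omega (r z)) - 1) is bounded by |z|, so it is the required subordinating function
   and no Schwarz lemma is needed.

   For sharpness take f = z exp (Q z) with z Q' = psi - 1, so that z f' / f = psi.  If r > R0,
   then at z = +-R0 / r a subordinating function would have to take the value sinh (+-a) = +-1,
   although |z| < 1.  When Re psi > 0, f is univalent because log f is, in the variable log z,
   a function on the left half-plane whose derivative has positive real part. *)

Require Import Defs.
From Stdlib Require Import Reals.
From Coquelicot Require Import Coquelicot.
From Stdlib Require Import Lra Lia Psatz.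
Open Scope R_scope.


(** What decides each radius is the quotient (psi z - 1) / z, which has an explicit form in every
    class. On |z| <= R0 its modulus attains its maximum a / R0 at a real point: at -R0 for L and RL,
    at R0 for the others. For most classes this follows from a triangle inequality or a convexity
    bound. For Delta and RL it is a genuine inequality in two real variables, shown only for
    parameters close to the actual ones; this is why decimal bounds for arcsinh 1 enter the proof of
    exact formulas.

    The extremal function requires a primitive Q that is analytic on the whole disk. Instead of a
    general theory of primitives, Q is written in closed form, with logarithms arranged so that
    their arguments have positive real part, where the principal branch is differentiable. Only the
    exponential class has no elementary primitive; there Q is an integral along the segment from 0
    to z, differentiated under the integral sign. *)

(** * Complex differentiability as an epsilon estimate *)

Definition cderiv (f : C -> C) (z l : C) : Prop :=
  forall eps : R, 0 < eps -> exists d : R, 0 < d /\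
    forall w : C, Cmod (w - z) < d ->
      Cmod (f w - f z - l * (w - z)) <= eps * Cmod (w - z).

(** The neighbourhoods are balls of the modulus, so the two notions differ only in the side on which
    the slope multiplies. The bound is undivided and non-strict, so w = z needs no exclusion. *)
Lemma cderiv_is_derive (f : C -> C) (z l : C) :
  cderiv f z l <-> @is_derive C_AbsRing C_NormedModule f z l.
Proof.
split.
- intros H. split.
  + apply is_linear_scal_l.
  + intros x Hx eps.
    rewrite <- (is_filter_lim_locally_unique _ _ Hx). clear x Hx.
    destruct (H eps (cond_pos eps)) as [d [Hd Hw]].
    exists (mkposreal d Hd). intros w Hball.
    specialize (Hw w Hball).
    change (Cmod (f w - f z - (w - z) * l) <= eps * Cmod (w - z)).
    rewrite (Cmult_comm (w - z)). exact Hw.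
- intros [_ H] eps Heps.
  specialize (H z (fun P HP => HP) (mkposreal eps Heps)).
  destruct H as [d Hd].
  exists d. split. { apply cond_pos. }
  intros w Hw. specialize (Hd w Hw).
  change (Cmod (f w - f z - (w - z) * l) <= eps * Cmod (w - z)) in Hd.
  rewrite (Cmult_comm l). exact Hd.
Qed.

Lemma Cmod_minus_sym (z w : C) : Cmod (z - w) = Cmod (w - z).
Proof. rewrite <- Cmod_opp. f_equal. ring. Qed.

Lemma Cmod_le_add_minus (z w : C) : Cmod z <= Cmod w + Cmod (z - w).
Proof. replace z with (w + (z - w))%C at 1 by ring. apply Cmod_triangle. Qed.

Lemma Cmod_minus_le (z w : C) : Cmod (z - w) <= Cmod z + Cmod w.
Proof.
  replace (z - w)%C with (z + - w)%C by ring.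
  rewrite <- (Cmod_opp w). apply Cmod_triangle.
Qed.

Lemma cderiv_lipschitz (f : C -> C) (z l : C) :
  cderiv f z l -> exists d : R, 0 < d /\
    forall w : C, Cmod (w - z) < d ->
      Cmod (f w - f z) <= (Cmod l + 1) * Cmod (w - z).
Proof.
intros H. destruct (H 1 Rlt_0_1) as [d [Hd Hw]].
exists d. split; [exact Hd|]. intros w Hwz. specialize (Hw w Hwz).
replace (f w - f z)%C with (l * (w - z) + (f w - f z - l * (w - z)))%C by ring.
eapply Rle_trans; [apply Cmod_triangle|]. rewrite Cmod_mult. lra.
Qed.

Lemma cderiv_continuous (f : C -> C) (z l : C) :
  cderiv f z l -> forall eps, 0 < eps -> exists d, 0 < d /\
    forall w, Cmod (w - z) < d -> Cmod (f w - f z) < eps.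
Proof.
intros H eps Heps. destruct (cderiv_lipschitz _ _ _ H) as [d [Hd Hw]].
pose proof (Cmod_ge_0 l).
assert (0 < eps / (Cmod l + 1)) by (apply Rdiv_lt_0_compat; lra).
exists (Rmin d (eps / (Cmod l + 1))). split; [now apply Rmin_glb_lt|].
intros w Hwz. eapply Rle_lt_trans.
- apply Hw. eapply Rlt_le_trans; [exact Hwz|apply Rmin_l].
- apply Rmult_lt_reg_r with (/ (Cmod l + 1)). { apply Rinv_0_lt_compat; lra. }
  replace ((Cmod l + 1) * Cmod (w - z) * / (Cmod l + 1)) with (Cmod (w - z))
    by (field; lra).
  eapply Rlt_le_trans; [exact Hwz|]. apply Rmin_r.
Qed.

Lemma cderiv_ext_loc (f g : C -> C) (z l : C) (d : R) :
  0 < d -> (forall w, Cmod (w - z) < d -> f w = g w) -> cderiv f z l -> cderiv g z l.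
Proof.
intros Hd E H eps Heps. destruct (H eps Heps) as [d' [Hd' Hw]].
exists (Rmin d d'). split; [now apply Rmin_glb_lt|].
intros w Hwz. rewrite <- !E.
- apply Hw. eapply Rlt_le_trans; [exact Hwz|apply Rmin_r].
- replace (z - z)%C with (RtoC 0) by ring. now rewrite Cmod_0.
- eapply Rlt_le_trans; [exact Hwz|apply Rmin_l].
Qed.

Lemma cderiv_ext (f g : C -> C) (z l : C) :
  (forall w, f w = g w) -> cderiv f z l -> cderiv g z l.
Proof. intros E. apply (cderiv_ext_loc f g z l 1 Rlt_0_1). auto. Qed.

(** The inverse, exponential, root, logarithm and [Ein] all have an explicit remainder of second
    order, and this turns it into a derivative. [Rabs M + 1] makes the division legal for every
    [M]. *)
Lemma cderiv_quadratic (f : C -> C) (z l : C) (M d : R) :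
  0 < d ->
  (forall w, Cmod (w - z) < d ->
     Cmod (f w - f z - l * (w - z)) <= M * (Cmod (w - z) * Cmod (w - z))) ->
  cderiv f z l.
Proof.
intros Hd H eps Heps.
pose proof (Rabs_pos M).
assert (0 < eps / (Rabs M + 1)) by (apply Rdiv_lt_0_compat; lra).
exists (Rmin d (eps / (Rabs M + 1))). split; [now apply Rmin_glb_lt|].
intros w Hwz.
eapply Rle_trans; [apply H; eapply Rlt_le_trans; [exact Hwz|apply Rmin_l]|].
pose proof (Cmod_ge_0 (w - z)).
rewrite <- Rmult_assoc. apply Rmult_le_compat_r; [assumption|].
assert (Hs : Cmod (w - z) < eps / (Rabs M + 1))
  by (eapply Rlt_le_trans; [exact Hwz|apply Rmin_r]).
apply (Rmult_lt_compat_l (Rabs M + 1)) in Hs; [|lra].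
replace ((Rabs M + 1) * (eps / (Rabs M + 1))) with eps in Hs by (field; lra).
pose proof (Rle_abs M). nra.
Qed.

Lemma cderiv_const (c z : C) : cderiv (fun _ => c) z 0.
Proof.
apply (cderiv_quadratic _ _ _ 0 1 Rlt_0_1). intros w _.
replace (c - c - 0 * (w - z))%C with (RtoC 0) by ring. rewrite Cmod_0. lra.
Qed.

Lemma cderiv_id (z : C) : cderiv (fun w => w) z 1.
Proof.
apply (cderiv_quadratic _ _ _ 0 1 Rlt_0_1). intros w _.
replace (w - z - 1 * (w - z))%C with (RtoC 0) by ring. rewrite Cmod_0. lra.
Qed.

Lemma cderiv_plus (f g : C -> C) (z l m : C) :
  cderiv f z l -> cderiv g z m -> cderiv (fun w => f w + g w)%C z (l + m).
Proof.
intros Hf Hg eps Heps.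
destruct (Hf (eps / 2)) as [d1 [Hd1 H1]]; [lra|].
destruct (Hg (eps / 2)) as [d2 [Hd2 H2]]; [lra|].
exists (Rmin d1 d2). split; [now apply Rmin_glb_lt|]. intros w Hw.
specialize (H1 w (Rlt_le_trans _ _ _ Hw (Rmin_l _ _))).
specialize (H2 w (Rlt_le_trans _ _ _ Hw (Rmin_r _ _))).
replace (f w + g w - (f z + g z) - (l + m) * (w - z))%C
  with ((f w - f z - l * (w - z)) + (g w - g z - m * (w - z)))%C by ring.
eapply Rle_trans; [apply Cmod_triangle|]. lra.
Qed.

Lemma cderiv_mult (f g : C -> C) (z l m : C) :
  cderiv f z l -> cderiv g z m ->
  cderiv (fun w => f w * g w)%C z (l * g z + f z * m).
Proof.
intros Hf Hg eps Heps.
set (K := 1 + Cmod (g z) + Cmod l + Cmod (f z)).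
pose proof (Cmod_ge_0 (g z)) as Pg. pose proof (Cmod_ge_0 l) as Pl.
pose proof (Cmod_ge_0 (f z)) as Pf.
assert (HK : 0 < K) by (unfold K; lra).
(* e <= 1 bounds |g w| by 1 + |g z|; e K <= eps then absorbs the three error terms together. *)
set (e := Rmin 1 (eps / K)).
assert (He : 0 < e) by (apply Rmin_glb_lt; [lra|now apply Rdiv_lt_0_compat]).
assert (He1 : e <= 1) by apply Rmin_l.
assert (HeK : e * K <= eps).
{ apply Rle_trans with (eps / K * K).
  - apply Rmult_le_compat_r; [lra|apply Rmin_r].
  - right. field. lra. }
destruct (Hf e He) as [d1 [Hd1 H1]].
destruct (Hg e He) as [d2 [Hd2 H2]].
destruct (cderiv_continuous _ _ _ Hg e He) as [d3 [Hd3 H3]].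
exists (Rmin d1 (Rmin d2 d3)).
split; [repeat apply Rmin_glb_lt; assumption|]. intros w Hw.
assert (W1 : Cmod (w - z) < d1) by (eapply Rlt_le_trans; [exact Hw|apply Rmin_l]).
assert (W2 : Cmod (w - z) < Rmin d2 d3) by (eapply Rlt_le_trans; [exact Hw|apply Rmin_r]).
assert (W3 : Cmod (w - z) < d3) by (eapply Rlt_le_trans; [exact W2|apply Rmin_r]).
assert (W4 : Cmod (w - z) < d2) by (eapply Rlt_le_trans; [exact W2|apply Rmin_l]).
specialize (H1 w W1). specialize (H2 w W4). specialize (H3 w W3).
replace (f w * g w - f z * g z - (l * g z + f z * m) * (w - z))%C
  with ((f w - f z - l * (w - z)) * g w + (l * (w - z) * (g w - g z)
        + f z * (g w - g z - m * (w - z))))%C by ring.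
eapply Rle_trans; [apply Cmod_triangle|].
eapply Rle_trans; [apply Rplus_le_compat_l; apply Cmod_triangle|].
rewrite !Cmod_mult.
pose proof (Cmod_le_add_minus (g w) (g z)) as H4.
assert (A1 : Cmod (f w - f z - l * (w - z)) * Cmod (g w)
             <= e * Cmod (w - z) * (1 + Cmod (g z))).
{ apply Rmult_le_compat; try apply Cmod_ge_0; lra. }
assert (A2 : Cmod l * Cmod (w - z) * Cmod (g w - g z) <= Cmod l * Cmod (w - z) * e).
{ apply Rmult_le_compat_l; [apply Rmult_le_pos; apply Cmod_ge_0|lra]. }
assert (A3 : Cmod (f z) * Cmod (g w - g z - m * (w - z)) <= Cmod (f z) * (e * Cmod (w - z))).
{ apply Rmult_le_compat_l; [apply Cmod_ge_0|lra]. }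
apply Rle_trans with (e * K * Cmod (w - z)).
- unfold K. lra.
- apply Rmult_le_compat_r; [apply Cmod_ge_0|exact HeK].
Qed.

Lemma cderiv_comp (f g : C -> C) (z l m : C) :
  cderiv f (g z) l -> cderiv g z m -> cderiv (fun w => f (g w)) z (l * m).
Proof.
intros Hf Hg eps Heps.
pose proof (Cmod_ge_0 l) as Pl. pose proof (Cmod_ge_0 m) as Pm.
set (K := Cmod m + 1 + Cmod l).
assert (HK : 0 < K) by (unfold K; lra).
set (e := eps / K).
assert (He : 0 < e) by now apply Rdiv_lt_0_compat.
destruct (Hf e He) as [d1 [Hd1 H1]].
destruct (Hg e He) as [d2 [Hd2 H2]].
destruct (cderiv_continuous _ _ _ Hg d1 Hd1) as [d3 [Hd3 H3]].
destruct (cderiv_lipschitz _ _ _ Hg) as [d4 [Hd4 H4]].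
exists (Rmin d2 (Rmin d3 d4)).
split; [repeat apply Rmin_glb_lt; assumption|]. intros w Hw.
assert (W1 : Cmod (w - z) < d2) by (eapply Rlt_le_trans; [exact Hw|apply Rmin_l]).
assert (W2 : Cmod (w - z) < Rmin d3 d4) by (eapply Rlt_le_trans; [exact Hw|apply Rmin_r]).
assert (W3 : Cmod (w - z) < d3) by (eapply Rlt_le_trans; [exact W2|apply Rmin_l]).
assert (W4 : Cmod (w - z) < d4) by (eapply Rlt_le_trans; [exact W2|apply Rmin_r]).
specialize (H2 w W1). specialize (H3 w W3). specialize (H4 w W4).
specialize (H1 (g w) H3).
replace (f (g w) - f (g z) - l * m * (w - z))%C
  with ((f (g w) - f (g z) - l * (g w - g z)) + l * (g w - g z - m * (w - z)))%C by ring.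
eapply Rle_trans; [apply Cmod_triangle|]. rewrite Cmod_mult.
assert (A1 : Cmod l * Cmod (g w - g z - m * (w - z)) <= Cmod l * (e * Cmod (w - z)))
  by (apply Rmult_le_compat_l; lra).
assert (A2 : e * Cmod (g w - g z) <= e * ((Cmod m + 1) * Cmod (w - z)))
  by (apply Rmult_le_compat_l; lra).
replace eps with (e * K) by (unfold e; field; lra).
unfold K. lra.
Qed.

Lemma cderiv_inv (z : C) : z <> 0 -> cderiv Cinv z (- / (z * z)).
Proof.
intros Hz. pose proof (proj1 (Cmod_gt_0 z) Hz) as Hp.
apply (cderiv_quadratic _ _ _ (2 / (Cmod z * Cmod z * Cmod z)) (Cmod z / 2)); [lra|].
intros w Hw.
assert (Hwm : Cmod z / 2 <= Cmod w).
{ pose proof (Cmod_le_add_minus z w). rewrite (Cmod_minus_sym z w) in H. lra. }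
assert (Hw0 : w <> 0) by (apply Cmod_gt_0; lra).
(* The remainder is exactly (w - z)^2 / (w z^2), and |w| >= |z| / 2 on the chosen ball. *)
replace (/ w - / z - - / (z * z) * (w - z))%C
  with ((w - z) * (w - z) / (w * z * z))%C by (field; auto).
rewrite Cmod_div by (repeat apply Cmult_neq_0; auto).
rewrite !Cmod_mult.
replace (2 / (Cmod z * Cmod z * Cmod z) * (Cmod (w - z) * Cmod (w - z)))
  with (Cmod (w - z) * Cmod (w - z) * (/ (Cmod z / 2 * Cmod z * Cmod z)))
  by (field; lra).
apply Rmult_le_compat_l; [apply Rmult_le_pos; apply Cmod_ge_0|].
apply Rinv_le_contravar; [repeat apply Rmult_lt_0_compat; lra|].
repeat apply Rmult_le_compat_r; lra.
Qed.


(** * Complex exponential, square root and logarithm *)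

Lemma Ceq_parts (z w : C) : Re z = Re w -> Im z = Im w -> z = w.
Proof. destruct z, w. simpl. congruence. Qed.

Lemma Cmod_sq (z : C) : Cmod z * Cmod z = Re z * Re z + Im z * Im z.
Proof. pose proof (Cmod2_alt z). simpl in H. unfold Re, Im in *. lra. Qed.

Lemma Cmod_le_of_sq (z : C) (r : R) :
  0 <= r -> Re z * Re z + Im z * Im z <= r * r -> Cmod z <= r.
Proof.
intros Hr H. rewrite <- Cmod_sq in H. pose proof (Cmod_ge_0 z).
destruct (Rle_lt_dec (Cmod z) r); [assumption|]. nra.
Qed.

Lemma Cmod_lt_of_sq (z : C) (r : R) :
  0 <= r -> Re z * Re z + Im z * Im z < r * r -> Cmod z < r.
Proof.
intros Hr H. rewrite <- Cmod_sq in H. pose proof (Cmod_ge_0 z).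
destruct (Rlt_le_dec (Cmod z) r); [assumption|]. nra.
Qed.

Lemma Rabs_Re_le (z : C) : Rabs (Re z) <= Cmod z.
Proof. apply re_le_Cmod. Qed.

Lemma Rabs_Im_le (z : C) : Rabs (Im z) <= Cmod z.
Proof. eapply Rle_trans; [|apply Rmax_Cmod]. apply Rmax_r. Qed.

Lemma Cmod_le_parts (z : C) : Cmod z <= Rabs (Re z) + Rabs (Im z).
Proof.
pose proof (Rabs_pos (Re z)). pose proof (Rabs_pos (Im z)).
apply Cmod_le_of_sq; [lra|].
pose proof (Rsqr_abs (Re z)). pose proof (Rsqr_abs (Im z)). unfold Rsqr in *. nra.
Qed.

Lemma Cexp_plus (z w : C) : Cexp (z + w) = (Cexp z * Cexp w)%C.
Proof.
destruct z as [x y], w as [u v]. unfold Cexp, Cplus, Cmult; simpl.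
rewrite exp_plus, cos_plus, sin_plus. f_equal; ring.
Qed.

Lemma Cmod_Cexp (z : C) : Cmod (Cexp z) = exp (Re z).
Proof.
pose proof (exp_pos (Re z)). pose proof (Cmod_ge_0 (Cexp z)).
pose proof (Cmod_sq (Cexp z)). unfold Cexp in *; simpl in *.
pose proof (sin2_cos2 (Im z)). unfold Rsqr in *.
assert (Cmod (exp (Re z) * cos (Im z), exp (Re z) * sin (Im z)) *
        Cmod (exp (Re z) * cos (Im z), exp (Re z) * sin (Im z)) = exp (Re z) * exp (Re z)).
{ rewrite H1. replace (exp (Re z) * exp (Re z)) with
    (exp (Re z) * exp (Re z) * (sin (Im z) * sin (Im z) + cos (Im z) * cos (Im z)))
    by (rewrite H2; ring). ring. }
nra.
Qed.

Lemma Cexp_neq_0 (z : C) : Cexp z <> 0.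
Proof. apply Cmod_gt_0. rewrite Cmod_Cexp. apply exp_pos. Qed.

Lemma Cexp_RtoC (x : R) : Cexp (RtoC x) = RtoC (exp x).
Proof. apply Ceq_parts; simpl; rewrite ?cos_0, ?sin_0; ring. Qed.

Lemma Cexp_0 : Cexp 0 = 1.
Proof. rewrite Cexp_RtoC. now rewrite exp_0. Qed.

Lemma Cexp_opp (z : C) : Cexp (- z) = (/ Cexp z)%C.
Proof.
assert (Cexp (- z) * Cexp z = 1)%C.
{ rewrite <- Cexp_plus. replace (- z + z)%C with (RtoC 0) by ring. apply Cexp_0. }
pose proof (Cexp_neq_0 z).
rewrite <- (Cmult_1_l (/ Cexp z)), <- H. field. assumption.
Qed.

Lemma Rabs_sin_le (y : R) : Rabs (sin y) <= Rabs y.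
Proof.
assert (P : forall x, 0 < x -> Rabs (sin x) <= x).
{ intros x Hx. pose proof (sin_lt_x x Hx). apply Rabs_le. split; [|lra].
  destruct (Rle_lt_dec x 1).
  - pose proof PI2_1. pose proof (sin_ge_0 x). assert (0 <= sin x) by (apply H1; lra). lra.
  - pose proof (SIN_bound x). lra. }
destruct (Rtotal_order y 0) as [H|[H|H]].
- rewrite <- (Rabs_Ropp y), <- Rabs_Ropp, <- sin_neg, (Rabs_pos_eq (- y)) by lra.
  apply P. lra.
- subst. rewrite sin_0. lra.
- rewrite (Rabs_pos_eq y) by lra. now apply P.
Qed.

Lemma cos_ge_quadratic (y : R) : 1 - y * y / 2 <= cos y.
Proof.
replace y with (2 * (y / 2)) at 3 by field. rewrite cos_2a_sin.
pose proof (Rabs_sin_le (y / 2)).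
pose proof (Rsqr_le_abs_1 _ _ H). unfold Rsqr in *. lra.
Qed.

Lemma Rabs_sin_minus_id_le (y : R) : Rabs (sin y - y) <= y * y.
Proof.
assert (P : forall x, 0 < x -> x - x * x <= sin x).
{ intros x Hx.
  destruct (MVT_gen (fun t => sin t - t + t * t) 0 x (fun t => cos t - 1 + 2 * t))
    as [c [Hc E]].
  - intros t _. auto_derive; [trivial|ring].
  - intros t _. apply continuity_pt_filterlim.
    apply (ex_derive_continuous (fun t => sin t - t + t * t)). auto_derive. trivial.
  - rewrite Rmin_left, Rmax_right in Hc by lra. rewrite sin_0 in E.
    assert (0 <= cos c - 1 + 2 * c).
    { destruct (Rle_lt_dec c 1).
      - pose proof (cos_ge_quadratic c). nra.
      - pose proof (COS_bound c). lra. }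
    nra. }
assert (Q : forall x, 0 < x -> Rabs (sin x - x) <= x * x).
{ intros x Hx. pose proof (sin_lt_x x Hx). pose proof (P x Hx).
  rewrite Rabs_left1; lra. }
destruct (Rtotal_order y 0) as [H|[H|H]].
- rewrite <- Rabs_Ropp. replace (- (sin y - y)) with (sin (- y) - - y)
    by (rewrite sin_neg; ring).
  replace (y * y) with (- y * - y) by ring. apply Q. lra.
- subst. rewrite sin_0, Rminus_0_r, Rabs_R0. lra.
- now apply Q.
Qed.

Lemma Rabs_exp_minus_affine_le (x : R) :
  Rabs x <= / 2 -> Rabs (exp x - 1 - x) <= 2 * (x * x).
Proof.
intros H. apply Rabs_le_between in H.
pose proof (exp_ineq1_le x). rewrite Rabs_pos_eq by lra.
pose proof (exp_ineq1_le (- x)). pose proof (exp_pos x).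
assert (exp x * exp (- x) = 1) by (rewrite <- exp_plus, Rplus_opp_r; apply exp_0).
assert (exp x * (1 - x) <= 1) by nra. nra.
Qed.

(** The real and imaginary remainders are at most 2 x^2 + y^2 and 2 |x| |y| + y^2, and 2 |x| |y| <=
    x^2 + y^2 brings their sum to 3 |z|^2. *)
Lemma Cexp_minus_affine_le (z : C) :
  Cmod z <= / 2 -> Cmod (Cexp z - 1 - z) <= 3 * (Cmod z * Cmod z).
Proof.
intros Hz. pose proof (Rabs_Re_le z) as Hx. pose proof (Rabs_Im_le z) as Hy.
rewrite Cmod_sq. destruct z as [x y]; simpl in *.
pose proof (Rabs_exp_minus_affine_le x ltac:(lra)) as He.
pose proof (Rabs_sin_minus_id_le y) as Hs. pose proof (cos_ge_quadratic y) as Hc.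
pose proof (COS_bound y). pose proof (Rabs_sin_le y) as Hs'.
eapply Rle_trans; [apply Cmod_le_parts|]. unfold Cexp; simpl.
replace (exp x * cos y + - (1) + - x) with ((exp x - 1 - x) - exp x * (1 - cos y)) by ring.
replace (exp x * sin y + - 0 + - y) with ((exp x - 1) * sin y + (sin y - y)) by ring.
assert (Hx2 : Rabs x * Rabs x = x * x) by (symmetry; apply Rsqr_abs).
assert (Hy2 : Rabs y * Rabs y = y * y) by (symmetry; apply Rsqr_abs).
pose proof (Rabs_pos x). pose proof (Rabs_pos y).
assert (E1 : Rabs (exp x - 1) <= 2 * Rabs x).
{ replace (exp x - 1) with ((exp x - 1 - x) + x) by ring.
  eapply Rle_trans; [apply Rabs_triang|]. nra. }
assert (E2 : exp x <= 2).
{ apply Rabs_le_between in E1. lra. }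
pose proof (exp_pos x).
assert (T1 : Rabs (exp x - 1 - x - exp x * (1 - cos y)) <= 2 * (x * x) + y * y).
{ eapply Rle_trans; [apply Rabs_triang|]. rewrite Rabs_Ropp, Rabs_mult.
  rewrite (Rabs_pos_eq (exp x)), (Rabs_pos_eq (1 - cos y)) by lra. nra. }
assert (T2 : Rabs ((exp x - 1) * sin y + (sin y - y)) <= 2 * Rabs x * Rabs y + y * y).
{ eapply Rle_trans; [apply Rabs_triang|]. rewrite Rabs_mult.
  pose proof (Rabs_pos (exp x - 1)). pose proof (Rabs_pos (sin y)).
  assert (Rabs (exp x - 1) * Rabs (sin y) <= 2 * Rabs x * Rabs y)
    by (apply Rmult_le_compat; lra).
  lra. }
pose proof (Rle_0_sqr (Rabs x - Rabs y)). unfold Rsqr in *. lra.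
Qed.

Lemma cderiv_Cexp (z : C) : cderiv Cexp z (Cexp z).
Proof.
apply (cderiv_quadratic _ _ _ (3 * Cmod (Cexp z)) (/ 2)); [lra|].
intros w Hw. replace w with (z + (w - z))%C at 1 by ring. rewrite Cexp_plus.
replace (Cexp z * Cexp (w - z) - Cexp z - Cexp z * (w - z))%C
  with (Cexp z * (Cexp (w - z) - 1 - (w - z)))%C by ring.
rewrite Cmod_mult. pose proof (Cexp_minus_affine_le (w - z) ltac:(lra)).
pose proof (Cmod_ge_0 (Cexp z)). nra.
Qed.

(** The two square roots multiply to |Im z| / 2 because |z|^2 - (Re z)^2 = (Im z)^2; the sign factor
    in [Csqrt] restores the sign of Im z. *)
Lemma Csqrt_mult_self (z : C) : (Csqrt z * Csqrt z)%C = z.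
Proof.
pose proof (Rabs_Re_le z) as H. apply Rabs_le_between in H.
pose proof (Cmod_sq z) as Hm.
set (A := (Cmod z + Re z) / 2). set (B := (Cmod z - Re z) / 2).
assert (HA : sqrt A * sqrt A = A) by (apply sqrt_sqrt; unfold A; lra).
assert (HB : sqrt B * sqrt B = B) by (apply sqrt_sqrt; unfold B; lra).
assert (HAB : sqrt A * sqrt B = Rabs (Im z) / 2).
{ rewrite <- sqrt_mult by (unfold A, B; lra).
  replace (A * B) with ((Im z / 2)²) by (unfold A, B, Rsqr; lra).
  rewrite sqrt_Rsqr_abs. unfold Rdiv. rewrite Rabs_mult, (Rabs_pos_eq (/ 2)); lra. }
apply Ceq_parts; unfold Csqrt; fold A; fold B; destruct (Rlt_dec (Im z) 0) as [Hi|Hi]; simpl.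
1,2: replace (Re z) with (A - B) by (unfold A, B; lra); nra.
- rewrite Rabs_left in HAB by lra. nra.
- rewrite Rabs_pos_eq in HAB by lra. nra.
Qed.

Lemma Re_Csqrt_ge_0 (z : C) : 0 <= Re (Csqrt z).
Proof. unfold Csqrt; simpl. apply sqrt_pos. Qed.

Lemma Re_le_sqr_Re_Csqrt (z : C) : Re z <= Re (Csqrt z) * Re (Csqrt z).
Proof.
rewrite <- (Csqrt_mult_self z) at 1. destruct (Csqrt z) as [x y]; simpl. nra.
Qed.

Lemma Re_Csqrt_gt_0 (z : C) : 0 < Re z -> 0 < Re (Csqrt z).
Proof.
intros H. pose proof (Re_le_sqr_Re_Csqrt z). pose proof (Re_Csqrt_ge_0 z). nra.
Qed.

Lemma Re_gt_0_neq_0 (z : C) : 0 < Re z -> z <> 0.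
Proof. intros H E. rewrite E in H. simpl in H. lra. Qed.

(** Of the factors of s^2 - w^2 = 0, with s the principal root, s + w cannot vanish: Re s >= 0 and
    Re w > 0. *)
Lemma Csqrt_unique (z w : C) : 0 < Re w -> (w * w)%C = z -> Csqrt z = w.
Proof.
intros Hw E. pose proof (Csqrt_mult_self z) as Hs. pose proof (Re_Csqrt_ge_0 z).
assert (N : (Csqrt z + w)%C <> 0).
{ apply Re_gt_0_neq_0. change (0 < Re (Csqrt z) + Re w). lra. }
assert (Z : ((Csqrt z - w) * (Csqrt z + w))%C = 0).
{ replace ((Csqrt z - w) * (Csqrt z + w))%C with (Csqrt z * Csqrt z - w * w)%C by ring.
  rewrite Hs, E. ring. }
replace (Csqrt z) with ((Csqrt z - w) * (Csqrt z + w) / (Csqrt z + w) + w)%C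
  by (field; assumption).
rewrite Z. field. assumption.
Qed.

Lemma Csqrt_RtoC (x : R) : 0 < x -> Csqrt (RtoC x) = RtoC (sqrt x).
Proof.
intros H. apply Csqrt_unique; [simpl; now apply sqrt_lt_R0|].
rewrite <- RtoC_mult. now rewrite sqrt_sqrt by lra.
Qed.

(** With roots s of z and t of w, the remainder is exactly -(w - z)^2 / (2 s (t + s)^2). As Re t >=
    0 for every w, |t + s| >= Re s without any restriction on w, so the radius 1 is arbitrary. *)
Lemma cderiv_Csqrt (z : C) : 0 < Re z -> cderiv Csqrt z (/ (2 * Csqrt z)).
Proof.
intros Hz. pose proof (Re_Csqrt_gt_0 z Hz) as Hs.
set (s := Csqrt z) in *. set (r := Re s) in *.
apply (cderiv_quadratic _ _ _ (/ (r * r * (2 * r))) 1 Rlt_0_1). intros w _. fold s.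
pose proof (Re_Csqrt_ge_0 w) as Ht. set (t := Csqrt w) in *.
assert (Es : (s * s)%C = z) by apply Csqrt_mult_self.
assert (Et : (t * t)%C = w) by apply Csqrt_mult_self.
assert (Ns : s <> 0) by now apply Re_gt_0_neq_0.
assert (Nts : (t + s)%C <> 0).
{ apply Re_gt_0_neq_0. change (0 < Re t + Re s). unfold r in Hs. lra. }
assert (N2 : RtoC 2 <> 0) by (apply Re_gt_0_neq_0; simpl; lra).
assert (Ed : (w - z)%C = ((t - s) * (t + s))%C) by (rewrite <- Es, <- Et; ring).
replace (t - s - / (2 * s) * (w - z))%C
  with (- ((w - z) * (w - z) / ((t + s) * (t + s) * (2 * s))))%C
  by (rewrite Ed; field; auto).
rewrite Cmod_opp, Cmod_div by (repeat apply Cmult_neq_0; auto).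
rewrite !Cmod_mult, Cmod_R, (Rabs_pos_eq 2) by lra.
unfold Rdiv. rewrite Rmult_comm.
apply Rmult_le_compat_r; [apply Rmult_le_pos; apply Cmod_ge_0|].
assert (r <= Cmod s) by (pose proof (Rabs_Re_le s); unfold r; pose proof (Rle_abs (Re s)); lra).
assert (r <= Cmod (t + s)).
{ pose proof (Rabs_Re_le (t + s)). pose proof (Rle_abs (Re (t + s))).
  change (Re (t + s)) with (Re t + Re s) in *. unfold r. lra. }
apply Rinv_le_contravar; [repeat apply Rmult_lt_0_compat; lra|].
apply Rmult_le_compat; [nra|lra|nra|lra].
Qed.

Lemma Cexp_Clog (z : C) : z <> 0 -> Cexp (Clog z) = z.
Proof.
intros Hz. pose proof (proj1 (Cmod_gt_0 z) Hz) as Hm. pose proof (Cmod_sq z) as Hq.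
unfold Cexp, Clog, Carg; simpl. rewrite exp_ln by assumption.
pose proof (Rabs_Re_le z) as HR. apply Rabs_le_between in HR.
destruct (Rlt_dec 0 (Cmod z + Re z)) as [Hp|Hn].
(* t is the tangent of half the argument; the double-angle formulas give the cosine (1 - t^2) / (1 +
   t^2) and the sine 2 t / (1 + t^2). *)
- set (t := Im z / (Cmod z + Re z)).
  assert (Ht : 0 < 1 + t * t) by nra.
  assert (Hc : cos (atan t) * cos (atan t) = / (1 + t * t)).
  { rewrite cos_atan. unfold Rdiv. rewrite !Rmult_1_l, <- Rinv_mult. f_equal.
    apply sqrt_sqrt. unfold Rsqr. lra. }
  assert (Hs : sin (atan t) = t * cos (atan t)).
  { rewrite cos_atan, sin_atan. unfold Rdiv. ring. }
  rewrite cos_2a, sin_2a, Hs.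
  apply Ceq_parts; simpl.
  + replace (cos (atan t) * cos (atan t) - t * cos (atan t) * (t * cos (atan t)))
      with ((1 - t * t) * (cos (atan t) * cos (atan t))) by ring.
    rewrite Hc. apply Rmult_eq_reg_r with (1 + t * t); [|lra].
    replace (Cmod z * ((1 - t * t) * / (1 + t * t)) * (1 + t * t))
      with (Cmod z * (1 - t * t)) by (field; lra).
    unfold t. apply Rmult_eq_reg_r with ((Cmod z + Re z) * (Cmod z + Re z)); [|nra].
    field_simplify; [|lra|lra].
    replace (Im z ^ 2) with (Cmod z * Cmod z - Re z * Re z) by (rewrite Hq; ring). ring.
  + replace (2 * (t * cos (atan t)) * cos (atan t))
      with (2 * t * (cos (atan t) * cos (atan t))) by ring.
    rewrite Hc. apply Rmult_eq_reg_r with (1 + t * t); [|lra].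
    replace (Cmod z * (2 * t * / (1 + t * t)) * (1 + t * t))
      with (Cmod z * (2 * t)) by (field; lra).
    unfold t. apply Rmult_eq_reg_r with ((Cmod z + Re z) * (Cmod z + Re z)); [|nra].
    field_simplify; [|lra|lra].
    replace (Im z ^ 3) with (Im z * (Cmod z * Cmod z - Re z * Re z)) by (rewrite Hq; ring).
    ring.
- rewrite cos_PI, sin_PI.
  apply Ceq_parts; simpl; [lra|].
  assert (E : Cmod z = - Re z) by lra. rewrite E in Hq.
  assert (Im z * Im z = 0) by lra. nra.
Qed.

Lemma Clog_Cexp (z : C) : Rabs (Im z) < PI -> Clog (Cexp z) = z.
Proof.
intros H. apply Rabs_lt_between in H.
unfold Clog, Carg. rewrite Cmod_Cexp, ln_exp.
apply Ceq_parts; simpl; [reflexivity|].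
set (y := Im z) in *. pose proof (exp_pos (Re z)).
assert (Hc : 0 < cos (y / 2)) by (apply cos_gt_0; lra).
assert (E1 : cos y = 2 * cos (y / 2) * cos (y / 2) - 1)
  by (rewrite <- cos_2a_cos; f_equal; field).
assert (E2 : sin y = 2 * sin (y / 2) * cos (y / 2))
  by (rewrite <- sin_2a; f_equal; field).
assert (0 < cos (y / 2) * cos (y / 2)) by nra.
destruct (Rlt_dec 0 (exp (Re z) + exp (Re z) * cos y)) as [Hp|Hn].
- replace (exp (Re z) * sin y / (exp (Re z) + exp (Re z) * cos y)) with (tan (y / 2)).
  + rewrite atan_tan by lra. field.
  + unfold tan. rewrite E1, E2. field. split; [|lra]. rewrite <- E1. lra.
- exfalso. apply Hn. rewrite E1. nra.
Qed.

Lemma Cmod_continuous (z : C) : continuous Cmod z.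
Proof.
apply (continuous_comp (fun z : C => fst z ^ 2 + snd z ^ 2) sqrt z).
- apply @continuous_plus; (apply (continuous_comp _ (fun x => x ^ 2));
    [first [apply continuous_fst|apply continuous_snd]|]);
  apply (ex_derive_continuous (fun x : R => x ^ 2)); auto_derive; trivial.
- apply continuous_sqrt.
Qed.

(** Continuity is all that the derivative of an inverse of [Cexp] requires. Near z the sum |w| + Re
    w stays positive, so only one branch of [Carg] occurs. *)
Lemma Clog_continuous (z : C) : 0 < Re z ->
  forall eps, 0 < eps -> exists d, 0 < d /\
    forall w, Cmod (w - z) < d -> Cmod (Clog w - Clog z) < eps.
Proof.
intros Hz eps Heps.
pose proof (Rabs_Re_le z) as HR. pose proof (Rle_abs (Re z)).
assert (C1 : continuous (fun w : C => ln (Cmod w)) z).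
{ apply (continuous_comp Cmod ln); [apply Cmod_continuous|].
  apply (ex_derive_continuous ln). auto_derive. lra. }
assert (CS : continuous (fun w : C => Cmod w + Re w) z).
{ apply @continuous_plus; [apply Cmod_continuous|apply continuous_fst]. }
assert (C2 : continuous (fun w : C => 2 * atan (Im w / (Cmod w + Re w))) z).
{ apply (continuous_comp (fun w : C => Im w / (Cmod w + Re w)) (fun x => 2 * atan x)).
  - apply (continuous_mult (fun w : C => Im w) (fun w : C => / (Cmod w + Re w))).
    + apply continuous_snd.
    + apply (continuous_comp _ Rinv); [exact CS|].
      apply (ex_derive_continuous Rinv). auto_derive. lra.
  - apply (ex_derive_continuous (fun x => 2 * atan x)). auto_derive. trivial. }
assert (He : 0 < eps / 3) by lra. set (e := mkposreal (eps / 3) He).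
assert (HS : 0 < Cmod z + Re z) by lra.
specialize (C1 (ball _ e) (locally_ball _ e)).
specialize (C2 (ball _ e) (locally_ball _ e)).
specialize (CS (ball _ (mkposreal _ HS)) (locally_ball _ _)).
destruct (filter_and (F := locally z) _ _ C1 (filter_and (F := locally z) _ _ C2 CS))
  as [d Hd].
exists d. split; [apply cond_pos|]. intros w Hw.
(* The balls of [C_UniformSpace] are squares in the two coordinates, and a disk of the same radius
   lies inside. *)
assert (Hb : @ball C_UniformSpace z d w).
{ split; [pose proof (Rabs_Re_le (w - z))|pose proof (Rabs_Im_le (w - z))];
  eapply Rle_lt_trans; eauto. }
destruct (Hd w Hb) as [B1 [B2 BS]]. clear Hd.
change (Rabs (ln (Cmod w) - ln (Cmod z)) < eps / 3) in B1.
change (Rabs (2 * atan (Im w / (Cmod w + Re w)) - 2 * atan (Im z / (Cmod z + Re z)))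
        < eps / 3) in B2.
change (Rabs (Cmod w + Re w - (Cmod z + Re z)) < Cmod z + Re z) in BS.
apply Rabs_lt_between in BS.
eapply Rle_lt_trans; [apply Cmod_le_parts|]. unfold Clog, Carg; simpl.
destruct (Rlt_dec 0 (Cmod w + Re w)); [|lra].
destruct (Rlt_dec 0 (Cmod z + Re z)); [|lra]. unfold Rminus in *. lra.
Qed.

(** For k = [Clog w - Clog z] one has exp k = 1 + u with u = (w - z) / z, hence |u - k| <= 3 |k|^2.
    Continuity gives |k| < 1/6, so |k| <= 2 |u| and the error is at most 12 |u|^2. *)
Lemma cderiv_Clog (z : C) : 0 < Re z -> cderiv Clog z (/ z).
Proof.
intros Hz. pose proof (Re_gt_0_neq_0 z Hz) as Nz.
pose proof (proj1 (Cmod_gt_0 z) Nz) as Pz.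
destruct (Clog_continuous z Hz (/ 6) ltac:(lra)) as [d [Hd Hw]].
apply (cderiv_quadratic _ _ _ (12 / (Cmod z * Cmod z)) (Rmin d (Cmod z))).
{ now apply Rmin_glb_lt. }
intros w Hwz.
assert (W1 : Cmod (w - z) < d) by (eapply Rlt_le_trans; [exact Hwz|apply Rmin_l]).
assert (W2 : Cmod (w - z) < Cmod z) by (eapply Rlt_le_trans; [exact Hwz|apply Rmin_r]).
assert (Nw : w <> 0).
{ intros E. subst. rewrite Cmod_minus_sym in W2.
  replace (z - 0)%C with z in W2 by ring. lra. }
specialize (Hw w W1). set (k := (Clog w - Clog z)%C) in *.
assert (Ek : Cexp k = (w / z)%C).
{ unfold k, Cminus. rewrite Cexp_plus, Cexp_opp, !Cexp_Clog by assumption. reflexivity. }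
pose proof (Cexp_minus_affine_le k ltac:(lra)) as Hk.
rewrite Ek in Hk.
set (u := (/ z * (w - z))%C) in *.
replace (w / z - 1 - k)%C with (u - k)%C in Hk by (unfold u; field; assumption).
pose proof (Cmod_le_add_minus k u) as T. rewrite (Cmod_minus_sym k u) in T.
pose proof (Cmod_ge_0 k). rewrite (Cmod_minus_sym k u).
assert (Hku : Cmod k <= 2 * Cmod u) by nra.
replace (12 / (Cmod z * Cmod z) * (Cmod (w - z) * Cmod (w - z)))
  with (12 * (Cmod u * Cmod u)).
- eapply Rle_trans; [exact Hk|]. nra.
- unfold u. rewrite Cmod_mult, Cmod_inv by assumption. field. lra.
Qed.


(** * Convexity bounds, complex sinh and its inverse *)

Lemma mean_value (f df : R -> R) (a b : R) : a < b ->
  (forall x, a <= x <= b -> is_derive f x (df x)) ->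
  exists c, a <= c <= b /\ f b - f a = df c * (b - a).
Proof.
intros Hab H. destruct (MVT_gen f a b df) as [c Hc].
- rewrite Rmin_left, Rmax_right by lra. intros x Hx. apply H. lra.
- rewrite Rmin_left, Rmax_right by lra. intros x Hx.
  apply continuity_pt_filterlim. apply (ex_derive_continuous f). exists (df x). now apply H.
- rewrite Rmin_left, Rmax_right in Hc by lra. now exists c.
Qed.

(** Mean-value points c <= h <= c' order the slopes of f over [0, h] and [h, a]. It is applied to
    sinh and to exp - 1. *)
Lemma le_chord (f df : R -> R) (h a : R) : 0 <= h <= a -> f 0 = 0 ->
  (forall x, 0 <= x <= a -> is_derive f x (df x)) ->
  (forall x y, 0 <= x <= y -> df x <= df y) ->
  f h * a <= h * f a.
Proof.
intros [H0 Ha] F0 Hd Hm.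
destruct H0 as [H0|H0]; [|subst; rewrite F0; lra].
destruct Ha as [Ha|Ha]; [|subst; lra].
destruct (mean_value f df 0 h H0) as [c [Hc E]]; [intros; apply Hd; lra|].
destruct (mean_value f df h a Ha) as [c' [Hc' E']]; [intros; apply Hd; lra|].
rewrite F0 in E. pose proof (Hm c c' ltac:(lra)).
replace (f h) with (df c * h) by lra. replace (f a) with (df c * h + df c' * (a - h)) by lra.
assert (df c * (h * (a - h)) <= df c' * (h * (a - h))) by (apply Rmult_le_compat_r; nra).
lra.
Qed.

Lemma cosh_ge_1 (x : R) : 1 <= cosh x.
Proof. unfold cosh. pose proof (exp_ineq1_le x). pose proof (exp_ineq1_le (- x)). lra. Qed.

Lemma cosh_sinh_sq (x : R) : cosh x * cosh x = 1 + sinh x * sinh x.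
Proof.
unfold cosh, sinh.
assert (exp x * exp (- x) = 1) by (rewrite <- exp_plus, Rplus_opp_r; apply exp_0). lra.
Qed.

Lemma is_derive_sinh (x : R) : is_derive sinh x (cosh x).
Proof. apply is_derive_Reals, derivable_pt_lim_sinh. Qed.

Lemma is_derive_cosh (x : R) : is_derive cosh x (sinh x).
Proof. apply is_derive_Reals, derivable_pt_lim_cosh. Qed.

Lemma sinh_minus_id_le (x y : R) : x <= y -> sinh x - x <= sinh y - y.
Proof.
intros [H|H]; [|subst; lra].
destruct (mean_value sinh cosh x y H (fun z _ => is_derive_sinh z)) as [c [_ E]].
pose proof (cosh_ge_1 c). nra.
Qed.

Lemma id_le_sinh (x : R) : 0 <= x -> x <= sinh x.
Proof. intros H. pose proof (sinh_minus_id_le 0 x H). rewrite sinh_0 in H0. lra. Qed.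

Lemma sinh_le_chord (h a : R) : 0 <= h <= a -> sinh h * a <= h * sinh a.
Proof.
intros H. apply (le_chord sinh cosh); auto.
- apply sinh_0.
- intros. apply is_derive_sinh.
- intros x y [Hx [Hy|Hy]]; [|subst; lra].
  destruct (mean_value cosh sinh x y Hy (fun z _ => is_derive_cosh z)) as [c [Hc E]].
  pose proof (id_le_sinh c ltac:(lra)). nra.
Qed.

(** sinh^2 t - t^2 = (sinh t - t) (sinh t + t) has two nonnegative increasing factors for t >= 0.
    This carries both the bound for complex sinh and the one for exp z - 1. *)
Lemma sinh_sq_minus_sq_le (x r : R) : Rabs x <= r ->
  sinh x * sinh x - x * x <= sinh r * sinh r - r * r.
Proof.
intros H.
assert (P : forall t, 0 <= t <= r -> sinh t * sinh t - t * t <= sinh r * sinh r - r * r).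
{ intros t [Ht Htr]. pose proof (sinh_minus_id_le t r Htr).
  pose proof (id_le_sinh t Ht). nra. }
destruct (Rle_dec 0 x) as [Hx|Hx].
- rewrite Rabs_pos_eq in H by assumption. apply P. lra.
- rewrite Rabs_left in H by lra. specialize (P (- x) ltac:(lra)).
  replace (sinh (- x)) with (- sinh x) in P; [lra|].
  unfold sinh. rewrite Ropp_involutive. field.
Qed.

Definition Csinh (z : C) : C := ((Cexp z - Cexp (- z)) / 2)%C.

Lemma Csinh_parts (z : C) :
  Csinh z = (sinh (Re z) * cos (Im z), cosh (Re z) * sin (Im z)).
Proof.
destruct z as [x y]. unfold Csinh, Cexp, sinh, cosh; simpl.
rewrite cos_neg, sin_neg. apply Ceq_parts; simpl; field.
Qed.

(** |sinh z|^2 = sinh^2 x + sin^2 y <= sinh^2 x + y^2, and y^2 = |z|^2 - x^2 reduces the claim to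
    monotonicity of sinh^2 t - t^2. *)
Lemma Cmod_Csinh_le (z : C) : Cmod (Csinh z) <= sinh (Cmod z).
Proof.
pose proof (Cmod_ge_0 z) as H0. pose proof (id_le_sinh _ H0).
apply Cmod_le_of_sq; [lra|]. rewrite Csinh_parts; simpl.
pose proof (sinh_sq_minus_sq_le _ _ (Rabs_Re_le z)). rewrite Cmod_sq in H1.
pose proof (Rsqr_le_abs_1 _ _ (Rabs_sin_le (Im z))).
pose proof (cosh_sinh_sq (Re z)). pose proof (sin2_cos2 (Im z)).
unfold Rsqr in *.
replace (sinh (Re z) * cos (Im z) * (sinh (Re z) * cos (Im z)) +
   cosh (Re z) * sin (Im z) * (cosh (Re z) * sin (Im z)))
 with (sinh (Re z) * sinh (Re z) * (cos (Im z) * cos (Im z)) +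
   (cosh (Re z) * cosh (Re z)) * (sin (Im z) * sin (Im z))) by ring.
rewrite H3. replace (cos (Im z) * cos (Im z)) with (1 - sin (Im z) * sin (Im z)) by lra.
lra.
Qed.

Lemma Csinh_0 : Csinh 0 = 0.
Proof.
unfold Csinh. replace (- 0)%C with (RtoC 0) by ring. rewrite Cexp_0. field.
Qed.

(** In this strip Re (cosh z) = cosh x cos y > 0, so cosh z is the principal root of 1 + sinh^2 z,
    and sinh z + cosh z = exp z. *)
Lemma Casinh_Csinh (z : C) : Rabs (Im z) < PI / 2 -> Casinh (Csinh z) = z.
Proof.
intros H. pose proof PI_RGT_0.
assert (E : Csqrt (1 + Csinh z * Csinh z) = ((Cexp z + Cexp (- z)) / 2)%C).
{ apply Csqrt_unique.
  - replace (Re ((Cexp z + Cexp (- z)) / 2)) with (cosh (Re z) * cos (Im z)).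
    + apply Rabs_lt_between in H. pose proof (cosh_ge_1 (Re z)).
      apply Rmult_lt_0_compat; [lra|]. apply cos_gt_0; lra.
    + destruct z as [x y]. unfold cosh, Cexp. simpl. rewrite cos_neg, sin_neg. field.
  - unfold Csinh. rewrite Cexp_opp. field. apply Cexp_neq_0. }
unfold Casinh. rewrite E. unfold Csinh.
replace ((Cexp z - Cexp (- z)) / 2 + (Cexp z + Cexp (- z)) / 2)%C with (Cexp z)
  by field.
apply Clog_Cexp. lra.
Qed.

(** No branch condition is required: only s^2 = 1 + z^2 is used, and z + s = 0 would give 1 = 0.
    Hence the sharpness argument can read off the value of an arbitrary subordinating function. *)
Lemma Casinh_inj_sinh (z w : C) : Casinh z = w -> z = Csinh w.
Proof.
intros <-. unfold Casinh. set (s := Csqrt (1 + z * z)).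
assert (Es : (s * s)%C = (1 + z * z)%C) by apply Csqrt_mult_self.
assert (N : (z + s)%C <> 0).
{ intros E. assert (E' : s = (- z)%C) by (replace s with ((z + s) - z)%C by ring; rewrite E; ring).
  rewrite E' in Es. assert (F : RtoC 1 = RtoC 0).
  { replace (RtoC 1) with ((1 + z * z) - z * z)%C by ring. rewrite <- Es. ring. }
  apply RtoC_inj in F. lra. }
unfold Csinh. rewrite Cexp_opp, Cexp_Clog by assumption.
replace ((z + s - / (z + s)) / 2)%C with ((z * z + 2 * z * s + s * s - 1) / (2 * (z + s)))%C
  by (field; assumption).
rewrite Es. field. assumption.
Qed.

Lemma Csinh_RtoC (x : R) : Csinh (RtoC x) = RtoC (sinh x).
Proof. rewrite Csinh_parts. simpl. rewrite cos_0, sin_0. apply Ceq_parts; simpl; ring. Qed.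

(** * Further derivative rules and dilations *)

Lemma cderiv_opp (f : C -> C) (z l : C) :
  cderiv f z l -> cderiv (fun w => - f w)%C z (- l).
Proof.
intros H. replace (- l)%C with (0 * f z + - (1) * l)%C by ring.
apply (cderiv_ext (fun w => - (1) * f w)%C); [intros; ring|].
apply (cderiv_mult (fun _ => - (1))%C); [apply cderiv_const|exact H].
Qed.

Lemma cderiv_eq (f : C -> C) (z l m : C) : l = m -> cderiv f z l -> cderiv f z m.
Proof. now intros ->. Qed.

Lemma cderiv_minus (f g : C -> C) (z l m : C) :
  cderiv f z l -> cderiv g z m -> cderiv (fun w => f w - g w)%C z (l - m).
Proof. intros Hf Hg. apply cderiv_plus; [exact Hf|now apply cderiv_opp]. Qed.

Lemma cderiv_scal (k : C) (f : C -> C) (z l : C) :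
  cderiv f z l -> cderiv (fun w => k * f w)%C z (k * l).
Proof.
intros H. apply (cderiv_eq _ _ (0 * f z + k * l)); [ring|].
apply (cderiv_mult (fun _ => k)); [apply cderiv_const|exact H].
Qed.

Lemma cderiv_div (f g : C -> C) (z l m : C) : g z <> 0 ->
  cderiv f z l -> cderiv g z m ->
  cderiv (fun w => f w / g w)%C z ((l * g z - f z * m) / (g z * g z)).
Proof.
intros N Hf Hg.
apply (cderiv_eq _ _ (l * / g z + f z * (- / (g z * g z) * m))); [field; assumption|].
apply (cderiv_mult f (fun w => / g w)%C); [exact Hf|]. apply (cderiv_comp Cinv); [now apply cderiv_inv|exact Hg].
Qed.

Lemma cderiv_Csinh (z : C) : cderiv Csinh z ((Cexp z + Cexp (- z)) / 2).
Proof.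
apply (cderiv_eq _ _ (/ 2 * (Cexp z - Cexp (- z) * - (1)))); [field|].
apply (cderiv_ext (fun w => / 2 * (Cexp w - Cexp (- w)))%C).
{ intros w. unfold Csinh. field. }
apply cderiv_scal, cderiv_minus; [apply cderiv_Cexp|].
apply (cderiv_comp Cexp); [apply cderiv_Cexp|]. apply cderiv_opp, cderiv_id.
Qed.

Definition cdifferentiable (f : C -> C) (z : C) : Prop := exists l, cderiv f z l.

Lemma cdifferentiable_ex_derive (f : C -> C) (z : C) :
  cdifferentiable f z <-> @ex_derive C_AbsRing C_NormedModule f z.
Proof. split; intros [l H]; exists l; now apply cderiv_is_derive. Qed.

Lemma cderiv_C_derive (f : C -> C) (z : C) :
  cdifferentiable f z -> cderiv f z (C_derive f z).
Proof.
intros [l H]. rewrite (is_C_derive_unique f z l); [exact H|]. now apply cderiv_is_derive.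
Qed.

Lemma C_derive_eq (f : C -> C) (z l : C) : cderiv f z l -> C_derive f z = l.
Proof. intros H. apply is_C_derive_unique. now apply cderiv_is_derive. Qed.

Lemma in_disk_0 : in_disk 0.
Proof. unfold in_disk. rewrite Cmod_0. lra. Qed.

Lemma Cmod_RtoC_mult (r : R) (z : C) : 0 < r -> Cmod (RtoC r * z) = r * Cmod z.
Proof. intros H. rewrite Cmod_mult, Cmod_R, Rabs_pos_eq by lra. reflexivity. Qed.

Lemma in_disk_dilate (r : R) (z : C) : 0 < r <= 1 -> in_disk z -> in_disk (RtoC r * z).
Proof.
intros H Hz. unfold in_disk in *. rewrite Cmod_RtoC_mult by lra.
pose proof (Cmod_ge_0 z). nra.
Qed.

Lemma RtoC_neq_0 (r : R) : 0 < r -> RtoC r <> 0.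
Proof. intros H. apply Re_gt_0_neq_0. exact H. Qed.

Lemma cderiv_dilate (r : R) (g : C -> C) (z l : C) : 0 < r ->
  cderiv g (RtoC r * z) l -> cderiv (dilate r g) z l.
Proof.
intros Hr H. pose proof (RtoC_neq_0 r Hr).
apply (cderiv_eq _ _ (/ RtoC r * (l * (RtoC r * 1)))); [field; assumption|].
unfold dilate. apply cderiv_scal. apply (cderiv_comp g); [exact H|].
apply cderiv_scal, cderiv_id.
Qed.

Lemma class_A_dilate (r : R) (g : C -> C) : 0 < r <= 1 -> class_A g -> class_A (dilate r g).
Proof.
intros Hr [Ha [H0 H1]].
assert (D : forall z, in_disk z -> cderiv (dilate r g) z (C_derive g (RtoC r * z))).
{ intros z Hz. apply cderiv_dilate; [lra|]. apply cderiv_C_derive, cdifferentiable_ex_derive, Ha.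
  now apply in_disk_dilate. }
split; [|split].
- intros z Hz. apply cdifferentiable_ex_derive. eexists. now apply D.
- unfold dilate. replace (RtoC r * 0)%C with (RtoC 0) by ring. rewrite H0. ring.
- rewrite (C_derive_eq _ _ _ (D 0 in_disk_0)).
  replace (RtoC r * 0)%C with (RtoC 0) by ring. exact H1.
Qed.

Lemma log_quotient_dilate (r : R) (g : C -> C) (z : C) : 0 < r <= 1 -> class_A g ->
  (forall z, in_disk z -> z <> 0 -> g z <> 0) -> in_disk z ->
  log_quotient (dilate r g) z = log_quotient g (RtoC r * z).
Proof.
intros Hr [Ha _] Hn Hz. pose proof (RtoC_neq_0 r (proj1 Hr)) as Nr.
unfold log_quotient.
destruct (Ceq_dec z 0) as [->|Nz]; destruct (Ceq_dec (RtoC r * _) 0) as [E|N]; auto.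
- exfalso. apply N. ring.
- exfalso. revert E. now apply Cmult_neq_0.
- rewrite (C_derive_eq (dilate r g) z (C_derive g (RtoC r * z))).
  + unfold dilate. field. split; [|assumption]. apply Hn; [now apply in_disk_dilate|assumption].
  + apply cderiv_dilate; [lra|].
    apply cderiv_C_derive, cdifferentiable_ex_derive, Ha. now apply in_disk_dilate.
Qed.

(** * Inclusion and sharpness for a general psi *)

(** A bound linear in |z| survives composition: |om (r z)| <= R0 |z| turns it into |psi (om (r z)) -
    1| <= a |z|, with R0 cancelled. *)
Lemma radius_property_of_bound (psi : C -> C) (G : (C -> C) -> Prop) (R0 : R) :
  arcsinh 1 < 1 -> 0 < arcsinh 1 -> 0 < R0 <= 1 ->
  (forall f, G f -> class_A f /\ quotient_subordinate psi f) ->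
  (forall z, in_disk z -> cdifferentiable psi z) ->
  (forall z, in_disk z -> Cmod z <= R0 -> Cmod (psi z - 1) <= arcsinh 1 / R0 * Cmod z) ->
  radius_property S_star_rho G R0.
Proof.
intros Ha1 Ha0 HR HG Hpsi Hb g Hg r Hr.
destruct (HG g Hg) as [HA [Hn [om [Hom [Hom0 [Homle Hsub]]]]]]. clear HG Hg.
assert (Hr1 : 0 < r <= 1) by lra.
set (a := arcsinh 1) in *.
assert (Sa : sinh a = 1) by apply sinh_arcsinh.
set (u := fun z => (psi (om (RtoC r * z)%C) - 1)%C).
assert (Hu : forall z, in_disk z -> Cmod (u z) <= a * Cmod z).
{ intros z Hz. pose proof (Homle _ (in_disk_dilate r z Hr1 Hz)) as H.
  rewrite Cmod_RtoC_mult in H by lra. pose proof (Cmod_ge_0 z). unfold in_disk in Hz.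
  assert (H' : Cmod (om (RtoC r * z)%C) <= R0 * Cmod z) by nra.
  assert (Cmod (om (RtoC r * z)%C) <= R0) by nra.
  eapply Rle_trans; [apply Hb; [unfold in_disk; nra|assumption]|].
  replace (a * Cmod z) with (a / R0 * (R0 * Cmod z)) by (field; lra).
  apply Rmult_le_compat_l; [|assumption]. apply Rdiv_le_0_compat; lra. }
split; [now apply class_A_dilate|split].
- intros z Hz Nz. unfold dilate. apply Cmult_neq_0.
  + intros E. assert (RtoC 1 = 0).
    { rewrite <- (Cinv_r (RtoC r)) by (apply RtoC_neq_0; lra). rewrite E. ring. }
    apply RtoC_inj in H. lra.
  + apply Hn; [now apply in_disk_dilate|]. apply Cmult_neq_0; [apply RtoC_neq_0; lra|assumption].
- exists (fun z => Csinh (u z)). split; [|split; [|split]].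
  + intros z Hz. apply cdifferentiable_ex_derive.
    pose proof (in_disk_dilate r z Hr1 Hz) as Hz'.
    destruct (proj2 (cdifferentiable_ex_derive om _) (Hom _ Hz')) as [l Hl].
    destruct (Hpsi (om (RtoC r * z)%C)) as [m Hm].
    { unfold in_disk in *. eapply Rle_lt_trans; [now apply Homle|assumption]. }
    eexists. apply (cderiv_comp Csinh); [apply cderiv_Csinh|].
    unfold u. apply cderiv_minus; [|apply cderiv_const].
    apply (cderiv_comp psi); [exact Hm|]. apply (cderiv_comp om); [exact Hl|].
    apply cderiv_scal, cderiv_id.
  + replace (u 0) with (RtoC 0); [apply Csinh_0|]. symmetry. apply Cmod_eq_0.
    pose proof (Hu 0 in_disk_0). rewrite Cmod_0 in H. pose proof (Cmod_ge_0 (u 0)). lra.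
  + intros z Hz. pose proof (Hu z Hz). pose proof (Cmod_ge_0 (u z)). unfold in_disk in Hz.
    eapply Rle_trans; [apply Cmod_Csinh_le|].
    pose proof (sinh_le_chord (Cmod (u z)) a ltac:(nra)). rewrite Sa in H1.
    apply Rmult_le_reg_r with a; [lra|]. lra.
  + intros z Hz. rewrite log_quotient_dilate by auto.
    rewrite Hsub by now apply in_disk_dilate.
    (* |Im u| <= a < 1 < PI / 2 keeps u in the strip where [Casinh] undoes [Csinh]. *)
    unfold psi_rho. rewrite Casinh_Csinh; [unfold u; ring|].
    pose proof (Hu z Hz). pose proof (Rabs_Im_le (u z)). pose proof PI2_1.
    unfold in_disk in Hz. nra.
Qed.

Lemma class_radius_upper_bound (psi : C -> C) (G : (C -> C) -> Prop) (f : C -> C)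
  (R0 x0 y0 : R) :
  0 < R0 -> Rabs x0 = R0 -> Rabs (sinh y0) = 1 -> psi (RtoC x0) = (1 + RtoC y0)%C ->
  G f -> class_A f -> (forall z, in_disk z -> z <> 0 -> f z <> 0) ->
  (forall z, in_disk z -> log_quotient f z = psi z) ->
  forall r0, 0 < r0 <= 1 -> radius_property S_star_rho G r0 -> r0 <= R0.
Proof.
intros HR Hx Hy Hpsi HG HA Hn Hq r0 Hr0 Hrad.
destruct (Rle_lt_dec r0 R0) as [|Hlt]; [assumption|exfalso].
destruct (Hrad f HG r0 ltac:(lra)) as [_ [_ [om [_ [_ [Homle Hsub]]]]]].
assert (Hm : Cmod (RtoC (x0 / r0)) = R0 / r0).
{ rewrite Cmod_R. unfold Rdiv. rewrite Rabs_mult, Hx, Rabs_inv, (Rabs_pos_eq r0); lra. }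
assert (Hz : in_disk (RtoC (x0 / r0))).
{ unfold in_disk. rewrite Hm. apply Rmult_lt_reg_r with r0; [lra|].
  replace (R0 / r0 * r0) with R0 by (field; lra). lra. }
specialize (Hsub _ Hz). specialize (Homle _ Hz).
rewrite log_quotient_dilate in Hsub by auto.
rewrite Hq in Hsub by now apply in_disk_dilate.
replace (RtoC r0 * RtoC (x0 / r0))%C with (RtoC x0) in Hsub
  by (rewrite <- RtoC_mult; f_equal; field; lra).
rewrite Hpsi in Hsub. unfold psi_rho in Hsub.
assert (E : Casinh (om (RtoC (x0 / r0))) = RtoC y0).
{ replace (Casinh (om (RtoC (x0 / r0)))) with ((1 + Casinh (om (RtoC (x0 / r0)))) - 1)%C by ring.
  rewrite <- Hsub. ring. }
apply Casinh_inj_sinh in E. rewrite Csinh_RtoC in E. rewrite E, Cmod_R, Hy in Homle.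
unfold in_disk in Hz. lra.
Qed.

(** * Extremal functions and their univalence *)

(** The factor k lets one real statement serve several ends: k = 1 / d gives the difference quotient
    in the univalence proof, while k = 1 and k = - Ci extract real and imaginary parts for
    integrals. *)
Lemma is_derive_Re_path (F : C -> C) (p d k l : C) (t : R) :
  cderiv F (p + RtoC t * d)%C l ->
  is_derive (fun s : R => Re (F (p + RtoC s * d) * k)%C) t (Re (l * d * k)%C).
Proof.
intros H. apply is_derive_Reals. intros eps Heps.
pose proof (Cmod_ge_0 d). pose proof (Cmod_ge_0 k).
(* The added ones keep K positive when d or k vanishes. *)
set (K := (Cmod d + 1) * (Cmod k + 1)).
assert (HK : 0 < K) by (apply Rmult_lt_0_compat; lra).
destruct (H (eps / 2 / K)) as [dl [Hdl Hw]]; [apply Rdiv_lt_0_compat; lra|].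
assert (Hdel : 0 < dl / (Cmod d + 1)) by (apply Rdiv_lt_0_compat; lra).
exists (mkposreal _ Hdel). intros h Nh Hh. simpl in Hh.
set (w := (p + RtoC (t + h) * d)%C). set (z := (p + RtoC t * d)%C) in *.
assert (Ew : (w - z)%C = (RtoC h * d)%C) by (unfold w, z; rewrite RtoC_plus; ring).
pose proof (Rabs_pos_lt h Nh).
assert (Mw : Cmod (w - z) = Rabs h * Cmod d) by (rewrite Ew, Cmod_mult, Cmod_R; reflexivity).
specialize (Hw w). rewrite Mw in Hw.
assert (Hlt : Rabs h * Cmod d < dl).
{ apply Rle_lt_trans with (Rabs h * (Cmod d + 1)); [apply Rmult_le_compat_l; lra|].
  replace dl with (dl / (Cmod d + 1) * (Cmod d + 1)) by (field; lra).
  apply Rmult_lt_compat_r; lra. }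
specialize (Hw Hlt).
replace ((Re (F w * k)%C - Re (F z * k)%C) / h - Re (l * d * k)%C)
  with (Re ((F w - F z - l * (w - z)) * k)%C / h).
2: { rewrite Ew. destruct (F w), (F z), k, l, d. simpl. field. assumption. }
unfold Rdiv. rewrite Rabs_mult, Rabs_inv.
apply Rmult_lt_reg_r with (Rabs h); [assumption|].
replace (Rabs (Re ((F w - F z - l * (w - z)) * k)%C) * / Rabs h * Rabs h)
  with (Rabs (Re ((F w - F z - l * (w - z)) * k)%C)) by (field; lra).
eapply Rle_lt_trans; [apply Rabs_Re_le|]. rewrite Cmod_mult.
apply Rle_lt_trans with (eps / 2 / K * (Rabs h * Cmod d) * Cmod k).
{ apply Rmult_le_compat_r; lra. }
apply Rle_lt_trans with (eps / 2 / K * Rabs h * K).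
- assert (Cmod d * Cmod k <= K) by (unfold K; nra).
  replace (eps / 2 / K * (Rabs h * Cmod d) * Cmod k)
    with (eps / 2 / K * Rabs h * (Cmod d * Cmod k)) by ring.
  apply Rmult_le_compat_l; [|assumption].
  apply Rmult_le_pos; [|lra]. apply Rlt_le, Rdiv_lt_0_compat; lra.
- replace (eps / 2 / K * Rabs h * K) with (eps / 2 * Rabs h) by (field; lra).
  apply Rmult_lt_compat_r; lra.
Qed.

Definition exp_extremal (Q : C -> C) (z : C) : C := (z * Cexp (Q z))%C.

Section Extremal.

(** q stands for (psi - 1) / z with its removable singularity filled in. The product form of [q_psi]
    avoids a case distinction at 0 and forces psi 0 = 1. *)
Variables psi Q q : C -> C.
Hypothesis Q_0 : Q 0 = 0.
Hypothesis Q_deriv : forall z, in_disk z -> cderiv Q z (q z).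
Hypothesis q_psi : forall z, in_disk z -> (z * q z)%C = (psi z - 1)%C.

Lemma cderiv_exp_extremal (z : C) : in_disk z ->
  cderiv (exp_extremal Q) z (Cexp (Q z) * psi z).
Proof.
intros Hz. apply (cderiv_eq _ _ (1 * Cexp (Q z) + z * (Cexp (Q z) * q z))).
- replace (1 * Cexp (Q z) + z * (Cexp (Q z) * q z))%C
    with (Cexp (Q z) * (1 + z * q z))%C by ring.
  rewrite q_psi by assumption. ring.
- apply (cderiv_mult (fun w => w) (fun w => Cexp (Q w))); [apply cderiv_id|].
  apply (cderiv_comp Cexp); [apply cderiv_Cexp|now apply Q_deriv].
Qed.

Lemma psi_0_of_primitive : psi 0 = 1.
Proof.
replace (psi 0) with ((psi 0 - 1) + 1)%C by ring. rewrite <- q_psi by apply in_disk_0. ring.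
Qed.

Lemma class_A_exp_extremal : class_A (exp_extremal Q).
Proof.
split; [|split].
- intros z Hz. apply cdifferentiable_ex_derive. eexists. now apply cderiv_exp_extremal.
- unfold exp_extremal. ring.
- rewrite (C_derive_eq _ _ _ (cderiv_exp_extremal 0 in_disk_0)).
  rewrite Q_0, Cexp_0, psi_0_of_primitive. ring.
Qed.

Lemma exp_extremal_neq_0 (z : C) : z <> 0 -> exp_extremal Q z <> 0.
Proof. intros H. apply Cmult_neq_0; [assumption|apply Cexp_neq_0]. Qed.

Lemma log_quotient_exp_extremal (z : C) : in_disk z ->
  log_quotient (exp_extremal Q) z = psi z.
Proof.
intros Hz. unfold log_quotient. destruct (Ceq_dec z 0) as [->|N].
- symmetry. apply psi_0_of_primitive.
- rewrite (C_derive_eq _ _ _ (cderiv_exp_extremal z Hz)). unfold exp_extremal.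
  field. split; [apply Cexp_neq_0|assumption].
Qed.

Lemma quotient_subordinate_exp_extremal : quotient_subordinate psi (exp_extremal Q).
Proof.
split.
- intros z _. apply exp_extremal_neq_0.
- exists (fun z => z). split; [|split; [reflexivity|split; [intros; lra|]]].
  + intros z _. apply cdifferentiable_ex_derive. eexists. apply cderiv_id.
  + apply log_quotient_exp_extremal.
Qed.

(* In the coordinate [p = log z] the function becomes [p + Q (exp p)], whose derivative
   [psi (exp p)] has positive real part on the convex left half-plane. *)
Lemma univalent_exp_extremal :
  (forall z, in_disk z -> 0 < Re (psi z)) -> univalent_disk (exp_extremal Q).
Proof.
intros Hre z w Hz Hw E.
destruct (Ceq_dec z 0) as [->|Nz].
{ destruct (Ceq_dec w 0) as [->|Nw]; [reflexivity|exfalso].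
  apply (exp_extremal_neq_0 w Nw). rewrite <- E. unfold exp_extremal. ring. }
destruct (Ceq_dec w 0) as [->|Nw].
{ exfalso. apply (exp_extremal_neq_0 z Nz). rewrite E. unfold exp_extremal. ring. }
(* p' is a logarithm of w, possibly different from [Clog w]; it is chosen so that F p = F p' holds
   with no multiple of 2 PI i left over. *)
set (p := Clog z). set (p' := (p + Q z - Q w)%C).
assert (Ep : Cexp p = z) by now apply Cexp_Clog.
assert (Ep' : Cexp p' = w).
{ unfold p', Cminus. rewrite !Cexp_plus, Cexp_opp, Ep.
  unfold exp_extremal in E. rewrite E. field. apply Cexp_neq_0. }
assert (Hp : forall u v, Cexp u = v -> in_disk v -> Re u < 0).
{ intros u v <- Hv. unfold in_disk in Hv. rewrite Cmod_Cexp, <- exp_0 in Hv.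
  now apply exp_lt_inv. }
pose proof (Hp _ _ Ep Hz) as Rp. pose proof (Hp _ _ Ep' Hw) as Rp'. clear Hp.
destruct (Ceq_dec p p') as [Epp|Npp]; [now rewrite <- Ep, <- Ep', Epp|exfalso].
set (d := (p - p')%C).
assert (Nd : d <> 0).
{ intros Ed. apply Npp. replace p with (d + p')%C by (unfold d; ring). rewrite Ed. ring. }
set (F := fun u => (u + Q (Cexp u))%C).
assert (HF : forall u, Re u < 0 -> cderiv F u (psi (Cexp u))).
{ intros u Hu.
  assert (Du : in_disk (Cexp u)).
  { unfold in_disk. rewrite Cmod_Cexp, <- exp_0. now apply exp_increasing. }
  apply (cderiv_eq _ _ (1 + q (Cexp u) * Cexp u)).
  - rewrite (Cmult_comm (q _)), q_psi by assumption. ring.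
  - apply (cderiv_plus (fun u => u)); [apply cderiv_id|].
    apply (cderiv_comp Q); [now apply Q_deriv|apply cderiv_Cexp]. }
assert (Rpath : forall t, 0 <= t <= 1 -> Re (p' + RtoC t * d)%C < 0).
{ intros t Ht. replace (Re (p' + RtoC t * d)%C) with ((1 - t) * Re p' + t * Re p)
    by (unfold d; destruct p, p'; simpl; ring).
  destruct (Rle_lt_dec t 0); nra. }
(* Division by d leaves psi alone as the derivative along the segment. The end values agree, so Re
   psi would vanish at some point of it. *)
destruct (mean_value (fun t => Re (F (p' + RtoC t * d)%C * / d)%C)
  (fun t => Re (psi (Cexp (p' + RtoC t * d)%C) * d * / d)%C) 0 1 Rlt_0_1) as [c [Hc Ec]].
{ intros t Ht. apply is_derive_Re_path, HF, Rpath, Ht. }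
replace (p' + RtoC 1 * d)%C with p in Ec by (unfold d; ring).
replace (p' + RtoC 0 * d)%C with p' in Ec by ring.
replace (F p) with (F p') in Ec.
2: { unfold F. rewrite Ep, Ep'. unfold p'. ring. }
replace (psi (Cexp (p' + RtoC c * d)) * d * / d)%C
  with (psi (Cexp (p' + RtoC c * d))) in Ec by (field; assumption).
assert (0 < Re (psi (Cexp (p' + RtoC c * d)%C))).
{ apply Hre. unfold in_disk. rewrite Cmod_Cexp, <- exp_0. apply exp_increasing, Rpath, Hc. }
lra.
Qed.

End Extremal.


(** * Decimal bounds for arcsinh 1 *)

(** Partial sums of the artanh series; ln ((1 + x) / (1 - x)) = 2 artanh x, and the terms decay like
    powers of x^2. *)
Fixpoint atanh_sum (n : nat) (x : R) : R :=
  match n with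
  | O => 0
  | S k => atanh_sum k x + x ^ (2 * k + 1) / INR (2 * k + 1)
  end.

Lemma is_derive_pow_div (k : nat) (x : R) :
  is_derive (fun t => t ^ (2 * k + 1) / INR (2 * k + 1)) x (x ^ (2 * k)).
Proof.
assert (INR (2 * k + 1) <> 0) by (apply not_0_INR; lia).
assert (P : forall m c, is_derive (fun t => t ^ m / c) x (INR m * x ^ pred m / c))
  by (intros; auto_derive; [trivial|unfold Rdiv; ring]).
specialize (P (2 * k + 1)%nat (INR (2 * k + 1))).
replace (pred (2 * k + 1)) with (2 * k)%nat in P by lia.
replace (x ^ (2 * k)) with (INR (2 * k + 1) * x ^ (2 * k) / INR (2 * k + 1))
  by (field; assumption).
exact P.
Qed.

Lemma is_derive_atanh_sum (n : nat) (x : R) : x * x <> 1 ->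
  is_derive (atanh_sum n) x ((1 - x ^ (2 * n)) / (1 - x * x)).
Proof.
intros Hx. induction n as [|n IH].
- simpl. replace ((1 - 1) / (1 - x * x)) with 0 by (field; lra). apply @is_derive_const.
- replace ((1 - x ^ (2 * S n)) / (1 - x * x))
    with ((1 - x ^ (2 * n)) / (1 - x * x) + x ^ (2 * n)).
  + simpl atanh_sum. apply @is_derive_plus; [exact IH|apply is_derive_pow_div].
  + replace (2 * S n)%nat with (S (S (2 * n))) by lia. simpl. field. lra.
Qed.

(** The truncation error has derivative 2 t^(2n) / (1 - t^2), which lies between 0 and 4 t^(2n)
    because t^2 <= 1/2. *)
Lemma ln_atanh_bounds (n : nat) (x : R) : 0 < x -> x * x <= / 2 ->
  2 * atanh_sum n x <= ln ((1 + x) / (1 - x))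
    <= 2 * atanh_sum n x + 4 * (x ^ (2 * n + 1) / INR (2 * n + 1)).
Proof.
intros H0 Hx.
assert (Hlt : forall t, 0 <= t <= x -> 0 <= t < 1 /\ t * t <= / 2) by (intros; nra).
assert (Hpow : forall t, 0 <= t -> 0 <= t ^ (2 * n)) by (intros; now apply pow_le).
assert (Hd : forall t, 0 <= t <= x -> is_derive
  (fun s => ln ((1 + s) / (1 - s)) - 2 * atanh_sum n s) t
  (2 * t ^ (2 * n) / (1 - t * t))).
{ intros t Ht. destruct (Hlt t Ht) as [H1 H2].
  replace (2 * t ^ (2 * n) / (1 - t * t))
    with (2 / (1 - t * t) - 2 * ((1 - t ^ (2 * n)) / (1 - t * t))) by (field; lra).
  apply @is_derive_minus.
  - auto_derive; [|field; lra].
    repeat split; [lra|]. apply Rdiv_lt_0_compat; lra.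
  - apply is_derive_scal, is_derive_atanh_sum. lra. }
assert (Hz : atanh_sum n 0 = 0).
{ clear. induction n as [|n IH]; [reflexivity|]. simpl. rewrite IH.
  replace (n + (n + 0) + 1)%nat with (S (n + n)) by lia. simpl. unfold Rdiv. ring. }
assert (Hp0 : 0 ^ (2 * n + 1) = 0) by (rewrite Nat.add_1_r; simpl; ring).
split.
- destruct (mean_value _ _ 0 x H0 Hd) as [c [Hc E]].
  replace ((1 + 0) / (1 - 0)) with 1 in E by field. rewrite ln_1, Hz in E.
  destruct (Hlt c Hc) as [H1 H2].
  assert (0 <= 2 * c ^ (2 * n) / (1 - c * c)).
  { apply Rdiv_le_0_compat; [|lra]. pose proof (Hpow c ltac:(lra)). lra. }
  nra.
- destruct (mean_value
    (fun s => ln ((1 + s) / (1 - s)) - 2 * atanh_sum n s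
              - 4 * (s ^ (2 * n + 1) / INR (2 * n + 1)))
    (fun t => 2 * t ^ (2 * n) / (1 - t * t) - 4 * t ^ (2 * n)) 0 x H0)
    as [c [Hc E]].
  { intros t Ht. apply @is_derive_minus; [now apply Hd|].
    apply is_derive_scal, is_derive_pow_div. }
  replace ((1 + 0) / (1 - 0)) with 1 in E by field. rewrite ln_1, Hz, Hp0 in E.
  destruct (Hlt c Hc) as [H1 H2].
  assert (2 * c ^ (2 * n) / (1 - c * c) <= 4 * c ^ (2 * n)).
  { apply Rmult_le_reg_r with (1 - c * c); [lra|].
    replace (2 * c ^ (2 * n) / (1 - c * c) * (1 - c * c)) with (2 * c ^ (2 * n)) by (field; lra).
    pose proof (Hpow c ltac:(lra)). nra. }
  replace (0 / INR (2 * n + 1)) with 0 in E by (unfold Rdiv; ring). nra.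
Qed.

Lemma sqrt_2_bounds : 1.4142135623 < sqrt 2 < 1.4142135624.
Proof.
pose proof (sqrt_pos 2). pose proof (sqrt_sqrt 2 ltac:(lra)). split; nra.
Qed.

Lemma arcsinh_1_eq : arcsinh 1 = ln (1 + sqrt 2).
Proof. unfold arcsinh. do 3 f_equal. ring. Qed.

Lemma ln_lower_bound (n : nat) (x l y : R) :
  0 < x -> x * x <= / 2 -> (1 + x) <= y * (1 - x) -> l <= 2 * atanh_sum n x -> l <= ln y.
Proof.
intros H0 Hx Hy Hl. assert (x < 1) by nra.
eapply Rle_trans; [exact Hl|].
eapply Rle_trans; [apply (ln_atanh_bounds n x H0 Hx)|].
apply ln_le; [apply Rdiv_lt_0_compat; lra|].
apply Rmult_le_reg_r with (1 - x); [lra|].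
replace ((1 + x) / (1 - x) * (1 - x)) with (1 + x) by (field; lra). lra.
Qed.

Lemma ln_upper_bound (n : nat) (x u y : R) :
  0 < x -> x * x <= / 2 -> 0 < y -> y * (1 - x) <= 1 + x ->
  2 * atanh_sum n x + 4 * (x ^ (2 * n + 1) / INR (2 * n + 1)) <= u -> ln y <= u.
Proof.
intros H0 Hx Hp Hy Hu. assert (x < 1) by nra.
eapply Rle_trans; [|exact Hu].
eapply Rle_trans; [|apply (ln_atanh_bounds n x H0 Hx)].
apply ln_le; [assumption|].
apply Rmult_le_reg_r with (1 - x); [lra|].
replace ((1 + x) / (1 - x) * (1 - x)) with (1 + x) by (field; lra). lra.
Qed.

Lemma arcsinh_1_bounds : 0.881373586 < arcsinh 1 < 0.881373588.
Proof.
pose proof sqrt_2_bounds as Hs. pose proof (sqrt_sqrt 2 ltac:(lra)).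
rewrite arcsinh_1_eq. split.
- apply Rlt_le_trans with 0.8813735861; [lra|].
  (* (1 + x) / (1 - x) = 1 + sqrt 2 has the solution x = sqrt 2 - 1, here rounded down, and rounded
     up for the other bound. Eleven terms leave an error below 10^-9. *)
  apply (ln_lower_bound 11 0.4142135623); [lra|lra|nra|]. simpl. lra.
- apply Rle_lt_trans with 0.8813735879; [|lra].
  apply (ln_upper_bound 11 0.4142135624); [lra|lra|lra|nra|]. simpl. lra.
Qed.


(** * From a primitive to a sharp radius *)

Lemma sinh_arcsinh_1_abs (y : R) : y = arcsinh 1 \/ y = - arcsinh 1 -> Rabs (sinh y) = 1.
Proof.
pose proof (sinh_arcsinh 1) as H. intros [->| ->].
- rewrite H. apply Rabs_R1.
- replace (sinh (- arcsinh 1)) with (- sinh (arcsinh 1)).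
  + rewrite H, Rabs_Ropp. apply Rabs_R1.
  + unfold sinh. rewrite Ropp_involutive. field.
Qed.

(** [G] stays abstract since [BS_star] asks for no univalence; the other five classes obtain
    membership of the extremal function from Re psi > 0. *)
Lemma is_class_radius_of_extremal (psi Q q : C -> C) (G : (C -> C) -> Prop) (R0 x0 y0 : R) :
  0 < R0 <= 1 ->
  (forall f, G f -> class_A f /\ quotient_subordinate psi f) ->
  G (exp_extremal Q) ->
  (forall z, in_disk z -> cdifferentiable psi z) ->
  (forall z, in_disk z -> Cmod z <= R0 -> Cmod (psi z - 1) <= arcsinh 1 / R0 * Cmod z) ->
  Q 0 = 0 ->
  (forall z, in_disk z -> cderiv Q z (q z)) ->
  (forall z, in_disk z -> (z * q z)%C = (psi z - 1)%C) ->
  Rabs x0 = R0 -> (y0 = arcsinh 1 \/ y0 = - arcsinh 1) ->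
  psi (RtoC x0) = (1 + RtoC y0)%C ->
  is_class_radius S_star_rho G R0.
Proof.
intros HR HG HE Hd Hb Q0 HQ Hq Hx Hy Hpsi. pose proof arcsinh_1_bounds as Ha.
split; [split; [assumption|]|].
- apply (radius_property_of_bound psi); auto; lra.
- apply (class_radius_upper_bound psi G (exp_extremal Q) R0 x0 y0); auto.
  + lra.
  + now apply sinh_arcsinh_1_abs.
  + eapply class_A_exp_extremal; eauto.
  + intros z _. apply exp_extremal_neq_0.
  + intros z Hz. eapply log_quotient_exp_extremal; eauto.
Qed.

Lemma S_star_radius_of_extremal (psi Q q : C -> C) (R0 x0 y0 : R) :
  0 < R0 <= 1 ->
  (forall z, in_disk z -> 0 < Re (psi z)) ->
  (forall z, in_disk z -> cdifferentiable psi z) ->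
  (forall z, in_disk z -> Cmod z <= R0 -> Cmod (psi z - 1) <= arcsinh 1 / R0 * Cmod z) ->
  Q 0 = 0 ->
  (forall z, in_disk z -> cderiv Q z (q z)) ->
  (forall z, in_disk z -> (z * q z)%C = (psi z - 1)%C) ->
  Rabs x0 = R0 -> (y0 = arcsinh 1 \/ y0 = - arcsinh 1) ->
  psi (RtoC x0) = (1 + RtoC y0)%C ->
  is_class_radius S_star_rho (S_star psi) R0.
Proof.
intros HR Hre Hd Hb Q0 HQ Hq Hx Hy Hpsi.
apply (is_class_radius_of_extremal psi Q q (S_star psi) R0 x0 y0); auto.
- intros f [[HA _] Hf]. auto.
- split; [split|].
  + eapply class_A_exp_extremal; eauto.
  + eapply univalent_exp_extremal; eauto.
  + eapply quotient_subordinate_exp_extremal; eauto.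
Qed.

Lemma Re_plus (z w : C) : Re (z + w)%C = Re z + Re w.
Proof. reflexivity. Qed.

Lemma Re_minus (z w : C) : Re (z - w)%C = Re z - Re w.
Proof. reflexivity. Qed.

Lemma Re_RtoC_mult (r : R) (z : C) : Re (RtoC r * z)%C = r * Re z.
Proof. destruct z. simpl. ring. Qed.

Lemma Re_le_Cmod (z : C) : - Cmod z <= Re z <= Cmod z.
Proof. apply Rabs_le_between, Rabs_Re_le. Qed.

Lemma Re_1_plus_gt_0 (z : C) : in_disk z -> 0 < Re (1 + z)%C.
Proof. intros H. rewrite Re_plus. pose proof (Re_le_Cmod z). unfold in_disk in H. simpl (Re 1). lra. Qed.

Lemma in_disk_sq (z : C) : in_disk z -> in_disk (z * z).
Proof.
unfold in_disk. intros H. rewrite Cmod_mult. pose proof (Cmod_ge_0 z). nra.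
Qed.

Lemma cderiv_Csqrt_comp (f : C -> C) (z l : C) : 0 < Re (f z) -> cderiv f z l ->
  cderiv (fun w => Csqrt (f w)) z (l / (2 * Csqrt (f z))).
Proof.
intros H Hf. apply (cderiv_eq _ _ (/ (2 * Csqrt (f z)) * l)).
- field. apply Re_gt_0_neq_0. now apply Re_Csqrt_gt_0.
- apply (cderiv_comp Csqrt); [now apply cderiv_Csqrt|assumption].
Qed.

Lemma cderiv_Clog_comp (f : C -> C) (z l : C) : 0 < Re (f z) -> cderiv f z l ->
  cderiv (fun w => Clog (f w)) z (l / f z).
Proof.
intros H Hf. apply (cderiv_eq _ _ (/ f z * l)).
- field. now apply Re_gt_0_neq_0.
- apply (cderiv_comp Clog); [now apply cderiv_Clog|assumption].
Qed.

Lemma Clog_1 : Clog 1 = 0.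
Proof.
rewrite <- Cexp_0. apply Clog_Cexp. simpl. rewrite Rabs_R0. apply PI_RGT_0.
Qed.

Lemma Csqrt_1 : Csqrt 1 = 1.
Proof. rewrite Csqrt_RtoC by lra. now rewrite sqrt_1. Qed.

Lemma Cmod_div_le (z w : C) (m k : R) : 0 < m -> m <= Cmod w -> / m <= k ->
  Cmod (z / w) <= k * Cmod z.
Proof.
intros Hm Hw Hk. rewrite Cmod_div by (apply Cmod_gt_0; lra).
unfold Rdiv. rewrite Rmult_comm. apply Rmult_le_compat_r; [apply Cmod_ge_0|].
eapply Rle_trans; [|exact Hk]. now apply Rinv_le_contravar.
Qed.

Lemma cderiv_1_plus (z : C) : cderiv (fun w => 1 + w)%C z 1.
Proof.
apply (cderiv_eq _ _ (0 + 1)); [ring|].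
apply (cderiv_plus (fun _ => RtoC 1) (fun w => w)); [apply cderiv_const|apply cderiv_id].
Qed.

Lemma cderiv_1_plus_sq (z : C) : cderiv (fun w => 1 + w * w)%C z (2 * z).
Proof.
apply (cderiv_eq _ _ (0 + (1 * z + z * 1))); [ring|].
apply (cderiv_plus (fun _ => RtoC 1) (fun w => w * w)%C); [apply cderiv_const|].
apply (cderiv_mult (fun w => w) (fun w => w)); apply cderiv_id.
Qed.

(** This logarithm occurs in the primitives for L and Delta. Halving makes it vanish at 0, where s =
    1, so that Q 0 = 0. *)
Lemma cderiv_log_half_1_plus (s : C -> C) (z l : C) : 0 < Re (s z) -> cderiv s z l ->
  cderiv (fun w => Clog ((1 + s w) / 2)) z (l / (1 + s z)).
Proof.
intros H Hs.
assert (N : (1 + s z)%C <> 0) by (apply Re_gt_0_neq_0; rewrite Re_plus; simpl (Re 1); lra).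
assert (E : forall w, ((1 + w) / 2)%C = (RtoC (/ 2) * (1 + w))%C).
{ intros w. rewrite RtoC_inv by lra. field. }
apply (cderiv_ext (fun w => Clog (RtoC (/ 2) * (1 + s w)))); [intros; now rewrite E|].
apply (cderiv_eq _ _ (RtoC (/ 2) * (0 + l) / (RtoC (/ 2) * (1 + s z)))).
- rewrite RtoC_inv by lra. field. assumption.
- apply (cderiv_Clog_comp (fun w => RtoC (/ 2) * (1 + s w))%C).
  + rewrite Re_RtoC_mult, Re_plus. simpl (Re 1). lra.
  + apply cderiv_scal. apply (cderiv_plus (fun _ => RtoC 1)); [apply cderiv_const|assumption].
Qed.

(** * The lemniscate, cardioid and lune classes *)

(** With s = sqrt (1 + z) the quotient (psi - 1) / z is 1 / (1 + s). It is largest where s is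
    smallest: (Re s)^2 >= Re (1 + z) >= 1 - R0 = (1 - a)^2, with equality at -R0. *)
Lemma radius_L : is_class_radius S_star_rho S_star_L (arcsinh 1 * (2 - arcsinh 1)).
Proof.
pose proof arcsinh_1_bounds as Ha. set (a := arcsinh 1) in *.
set (R0 := a * (2 - a)).
assert (HR : 0 < R0 <= 1) by (unfold R0; nra).
set (s := fun z => Csqrt (1 + z)).
assert (Hs : forall z, in_disk z -> 0 < Re (s z))
  by (intros z Hz; now apply Re_Csqrt_gt_0, Re_1_plus_gt_0).
assert (Ns : forall z, in_disk z -> s z <> 0) by (intros; now apply Re_gt_0_neq_0, Hs).
assert (N1 : forall z, in_disk z -> (1 + s z)%C <> 0).
{ intros z Hz. apply Re_gt_0_neq_0. rewrite Re_plus. specialize (Hs z Hz). simpl (Re 1). lra. }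
assert (Hsq : forall z, z = (s z * s z - 1)%C).
{ intros z. unfold s. rewrite Csqrt_mult_self. ring. }
assert (Ds : forall z, in_disk z -> cderiv s z (1 / (2 * s z))).
{ intros z Hz. apply (cderiv_Csqrt_comp (fun z => 1 + z)%C);
    [now apply Re_1_plus_gt_0|apply cderiv_1_plus]. }
(* Since dz = 2 s ds, the integrand 1 / (1 + s) becomes 2 - 2 / (1 + s) in the variable s. *)
apply (S_star_radius_of_extremal psi_L
  (fun z => 2 * (s z - 1) - 2 * Clog ((1 + s z) / 2))%C
  (fun z => / (1 + s z))%C R0 (- R0) (- a)); auto.
- intros z Hz. eexists. now apply Ds.
- intros z Hz HzR. fold a. change (psi_L z) with (s z).
  replace (s z - 1)%C with (z / (1 + s z))%C
    by (transitivity ((s z * s z - 1) / (1 + s z))%C; [now rewrite <- Hsq|field; auto]).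
  apply (Cmod_div_le _ _ (2 - a)); [lra| |].
  + pose proof (Re_le_Cmod (1 + s z)). rewrite Re_plus in H. simpl (Re 1) in H.
    pose proof (Re_le_sqr_Re_Csqrt (1 + z)) as H1. fold (s z) in H1.
    rewrite Re_plus in H1. simpl (Re 1) in H1. pose proof (Re_le_Cmod z).
    specialize (Hs z Hz).
    assert (1 - a <= Re (s z)) by (unfold R0 in HzR; nra). lra.
  + right. unfold R0. field. lra.
- unfold s. replace (1 + 0)%C with (RtoC 1) by ring. rewrite Csqrt_1.
  replace ((1 + 1) / 2)%C with (RtoC 1) by field. rewrite Clog_1. ring.
- intros z Hz. apply (cderiv_eq _ _ (2 * (1 / (2 * s z) - 0) - 2 * (1 / (2 * s z) / (1 + s z)))).
  + field. auto.
  + apply cderiv_minus; apply cderiv_scal.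
    * apply cderiv_minus; [auto|apply cderiv_const].
    * apply cderiv_log_half_1_plus; auto.
- intros z Hz. change (psi_L z) with (s z). transitivity ((s z * s z - 1) * / (1 + s z))%C; [now rewrite <- Hsq|field; auto].
- rewrite Rabs_Ropp, Rabs_pos_eq; lra.
- unfold psi_L. rewrite <- !RtoC_plus.
  replace (1 + - R0) with ((1 - a) * (1 - a)) by (unfold R0; ring).
  rewrite Csqrt_RtoC by nra. rewrite sqrt_square by lra. reflexivity.
Qed.

(** (psi - 1) / z = 4/3 + 2/3 z is bounded by the triangle inequality, with equality at R0, the
    positive root of x (4/3 + 2/3 x) = a. *)
Lemma radius_C : is_class_radius S_star_rho S_star_C
  (1 / 2 * (sqrt (2 * (2 + 3 * arcsinh 1)) - 2)).
Proof.
pose proof arcsinh_1_bounds as Ha. set (a := arcsinh 1) in *.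
set (R0 := 1 / 2 * (sqrt (2 * (2 + 3 * a)) - 2)).
assert (E : R0 * (4 / 3 + 2 / 3 * R0) = a).
{ pose proof (sqrt_sqrt (2 * (2 + 3 * a)) ltac:(lra)). unfold R0. nra. }
assert (HR : 0 < R0 <= 1).
{ pose proof (sqrt_pos (2 * (2 + 3 * a))).
  assert (-1 <= R0) by (unfold R0; lra). split; nra. }
assert (D : forall z, cderiv psi_C z (4 / 3 + 4 / 3 * z)).
{ intros z.
  apply (cderiv_ext (fun z => 1 + 4 / 3 * z + 2 / 3 * (z * z))%C);
    [intros; unfold psi_C; field|].
  apply (cderiv_eq _ _ (0 + 4 / 3 * 1 + 2 / 3 * (1 * z + z * 1))); [field|].
  apply cderiv_plus; [apply cderiv_plus; [apply cderiv_const|]|]; apply cderiv_scal.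
  - apply cderiv_id.
  - apply (cderiv_mult (fun w => w) (fun w => w)); apply cderiv_id. }
apply (S_star_radius_of_extremal psi_C
  (fun z => 4 / 3 * z + / 3 * (z * z))%C (fun z => 4 / 3 + 2 / 3 * z)%C R0 R0 a); auto.
- intros z Hz. unfold in_disk in Hz. pose proof (Cmod_sq z). pose proof (Cmod_ge_0 z).
  replace (Re (psi_C z)) with (1 + 4 / 3 * Re z + 2 / 3 * (Re z * Re z - Im z * Im z)).
  (* y^2 < 1 - x^2 leaves Re psi > (1 + 2 x)^2 / 3. *)
  + pose proof (Rle_0_sqr (1 + 2 * Re z)). unfold Rsqr in *. nra.
  + destruct z as [x y]. unfold psi_C. simpl. field.
- intros z Hz. eexists. apply D.
- intros z Hz HzR. fold a.
  replace (psi_C z - 1)%C with (z * (4 / 3 + 2 / 3 * z))%C by (unfold psi_C; field).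
  rewrite Cmod_mult, Rmult_comm. apply Rmult_le_compat_r; [apply Cmod_ge_0|].
  eapply Rle_trans; [apply Cmod_triangle|]. rewrite Cmod_mult.
  rewrite <- !RtoC_div, !Cmod_R, !Rabs_pos_eq by lra.
  rewrite <- E. replace (R0 * (4 / 3 + 2 / 3 * R0) / R0) with (4 / 3 + 2 / 3 * R0)
    by (field; lra). lra.
- ring.
- intros z _. apply (cderiv_eq _ _ (4 / 3 * 1 + / 3 * (1 * z + z * 1))); [field|].
  apply cderiv_plus; apply cderiv_scal; [apply cderiv_id|].
  apply (cderiv_mult (fun w => w) (fun w => w)); apply cderiv_id.
- intros z _. unfold psi_C. field.
- apply Rabs_pos_eq. lra.
- rewrite <- E. unfold psi_C.
  rewrite !RtoC_mult, !RtoC_plus, !RtoC_mult, !RtoC_div by lra. field.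
Qed.

(* If [|tau| < 1] and [|2 tau / (1 - tau^2)| <= 2 T / (1 - T^2)], then [|1 + tau| <= 1 + T],
   for [tau = x + i y]. *)
Lemma radius_Delta_aux (x y T : R) : 0.3 <= T <= 0.31 -> x * x + y * y < 1 ->
  (x * x + y * y) * ((1 - T * T) * (1 - T * T)) <=
    T * T * ((1 - x * x + y * y) * (1 - x * x + y * y) + 4 * (x * x) * (y * y)) ->
  (1 + x) * (1 + x) + y * y <= (1 + T) * (1 + T).
Proof.
intros HT Hv H. set (v := x * x + y * y) in *.
replace ((1 - x * x + y * y) * (1 - x * x + y * y) + 4 * (x * x) * (y * y))
  with ((1 + v) * (1 + v) - 4 * (x * x)) in H by (unfold v; ring).
replace ((1 + x) * (1 + x) + y * y) with (1 + 2 * x + v) by (unfold v; ring).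
destruct (Rle_lt_dec v (T * T)) as [Hs|Hs].
{ assert (x <= T) by (unfold v in *; nra). lra. }
destruct (Rle_lt_dec (1 + 2 * x + v) ((1 + T) * (1 + T))) as [|Hc]; [assumption|exfalso].
(* [Hc] says 2 x > L. If L >= 0 then L^2 < 4 x^2, and the identity [I] contradicts [H], because 1 -
   2 T - T^2 > 0. *)
set (L := T * T + 2 * T - v).
assert (I : T * T * (L * L) - T * T * ((1 + v) * (1 + v)) + v * ((1 - T * T) * (1 - T * T))
  = (1 + T) * (1 + T) * ((1 - 2 * T - T * T) * (v - T * T))) by (unfold L; ring).
assert (0 < 1 - 2 * T - T * T) by nra.
destruct (Rle_lt_dec 0 L) as [HL|HL].
- assert (L * L < 4 * (x * x)) by (unfold L in *; nra).
  assert (0 <= (1 + T) * (1 + T) * ((1 - 2 * T - T * T) * (v - T * T))).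
  { apply Rmult_le_pos; [nra|]. apply Rmult_le_pos; lra. }
  assert (0 < T * T) by nra. nra.
(* For L < 0 the modulus is so large that [H] fails by size alone: its left side exceeds 0.55, its
   right side is below 0.39. *)
- assert (0.69 < v) by (unfold L in HL; nra).
  assert (0.09 <= T * T <= 0.0961) by nra.
  assert (0 <= x * x) by nra.
  assert ((1 - T * T) * (1 - T * T) >= 0.8) by nra.
  nra.
Qed.

Lemma radius_Delta : is_class_radius S_star_rho Delta_star
  (arcsinh 1 * (2 + arcsinh 1) / (2 * (1 + arcsinh 1))).
Proof.
pose proof arcsinh_1_bounds as Ha. set (a := arcsinh 1) in *.
set (R0 := a * (2 + a) / (2 * (1 + a))).
assert (E : R0 * (2 * (1 + a)) = a * (2 + a)) by (unfold R0; field; lra).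
assert (HR : 0 < R0 <= 1) by (split; nra).
set (s := fun z => Csqrt (1 + z * z)).
assert (Hz2 : forall z, in_disk z -> 0 < Re (1 + z * z)%C)
  by (intros z Hz; now apply Re_1_plus_gt_0, in_disk_sq).
assert (Hs : forall z, in_disk z -> 0 < Re (s z))
  by (intros z Hz; now apply Re_Csqrt_gt_0, Hz2).
assert (Ns : forall z, in_disk z -> s z <> 0) by (intros; now apply Re_gt_0_neq_0, Hs).
assert (N1 : forall z, in_disk z -> (1 + s z)%C <> 0).
{ intros z Hz. apply Re_gt_0_neq_0. rewrite Re_plus. specialize (Hs z Hz). simpl (Re 1). lra. }
assert (Hsq : forall z, (s z * s z)%C = (1 + z * z)%C) by (intros z; apply Csqrt_mult_self).
assert (Ds : forall z, in_disk z -> cderiv s z (2 * z / (2 * s z))).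
{ intros z Hz. apply (cderiv_Csqrt_comp (fun z => 1 + z * z)%C);
    [now apply Hz2|apply cderiv_1_plus_sq]. }
assert (Hq : forall z, in_disk z -> (s z - 1)%C = (z * (z / (1 + s z)))%C).
{ intros z Hz. replace (z * (z / (1 + s z)))%C with ((1 + z * z - 1) / (1 + s z))%C
    by (field; auto). rewrite <- Hsq. field. auto. }
(* By s ds = z dz, the part (s - 1) / z = z / (1 + s) of the integrand becomes s / (1 + s) in the
   variable s, with primitive s - ln (1 + s). *)
apply (S_star_radius_of_extremal psi_Delta
  (fun z => z + (s z - 1 - Clog ((1 + s z) / 2)))%C
  (fun z => 1 + z / (1 + s z))%C R0 R0 a); auto.
- intros z Hz. unfold psi_Delta. fold (s z). rewrite Re_plus.
  (* (Re s)^2 = (|1 + z^2| + 1 + x^2 - y^2) / 2 exceeds x^2 because |z| < 1; hence Re s > |Re z|. *)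
  assert (Re (s z) * Re (s z) = (Cmod (1 + z * z) + Re (1 + z * z)%C) / 2).
  { unfold s, Csqrt. simpl (Re (_, _)). apply sqrt_sqrt.
    pose proof (Re_le_Cmod (1 + z * z)). lra. }
  unfold in_disk in Hz. pose proof (Cmod_sq z). pose proof (Cmod_ge_0 z).
  pose proof (Cmod_ge_0 (1 + z * z)).
  replace (Re (1 + z * z)%C) with (1 + (Re z * Re z - Im z * Im z)) in H
    by (destruct z; simpl; ring).
  assert (Hlt : Re z * Re z < Re (s z) * Re (s z)) by nra.
  specialize (Hs z Hz). nra.
- intros z Hz. eexists. unfold psi_Delta. apply cderiv_plus; [apply cderiv_id|now apply Ds].
- intros z Hz HzR. fold a. unfold psi_Delta. fold (s z).
  replace (z + s z - 1)%C with (z + (s z - 1))%C by ring. rewrite Hq by assumption.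
  (* In terms of [tau] the modulus to bound is [|1 + tau|], and [z = 2 tau / (1 - tau^2)]. *)
  set (tau := (z / (1 + s z))%C).
  replace (z + z * tau)%C with (z * (1 + tau))%C by ring.
  rewrite Cmod_mult, Rmult_comm. apply Rmult_le_compat_r; [apply Cmod_ge_0|].
  (* T is the value of tau at z = R0, where s = 1 + a - R0. *)
  set (T := a / (2 + a)).
  assert (ET : T * (2 + a) = a) by (unfold T; field; lra).
  replace (a / R0) with (1 + T) by (unfold T, R0; field; lra).
  assert (HT : 0.3 <= T <= 0.31) by (split; nra).
  assert (Etau : (z * (1 - tau * tau))%C = (2 * tau)%C).
  { unfold tau.
    replace (z * (1 - z / (1 + s z) * (z / (1 + s z))))%C
      with (z * (2 * s z + 1 + (s z * s z - z * z)) / ((1 + s z) * (1 + s z)))%C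
      by (field; auto).
    rewrite Hsq. field. auto. }
  (* |z|^2 = |s - 1| |s + 1| < |s + 1|^2, as Re s > 0. *)
  assert (Ht1 : Cmod tau < 1).
  { unfold tau. rewrite Cmod_div by auto.
    apply Rmult_lt_reg_r with (Cmod (1 + s z)); [now apply Cmod_gt_0, N1|].
    unfold Rdiv. rewrite Rmult_assoc, Rinv_l, Rmult_1_r, Rmult_1_l
      by (apply Rgt_not_eq, Cmod_gt_0; auto).
    assert (Cmod z * Cmod z < Cmod (1 + s z) * Cmod (1 + s z)).
    { rewrite <- Cmod_mult. replace (z * z)%C with ((s z - 1) * (1 + s z))%C.
      2: { replace ((s z - 1) * (1 + s z))%C with (s z * s z - 1)%C by ring.
           rewrite Hsq. ring. }
      rewrite Cmod_mult. apply Rmult_lt_compat_r; [now apply Cmod_gt_0, N1|].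
      apply Cmod_lt_of_sq; [apply Cmod_ge_0|]. rewrite Cmod_sq.
      specialize (Hs z Hz). destruct (s z) as [u v]; simpl in *. nra. }
    pose proof (Cmod_ge_0 z). pose proof (Cmod_ge_0 (1 + s z)). nra. }
  assert (Hc : Cmod tau * (1 - T * T) <= T * Cmod (1 - tau * tau)).
  { apply (f_equal Cmod) in Etau. rewrite !Cmod_mult, Cmod_R, (Rabs_pos_eq 2) in Etau by lra.
    assert (2 * Cmod tau <= R0 * Cmod (1 - tau * tau)).
    { rewrite <- Etau. apply Rmult_le_compat_r; [apply Cmod_ge_0|assumption]. }
    assert (E0 : R0 * (1 - T * T) = 2 * T) by (unfold R0, T; field; lra).
    assert (0 < 1 - T * T) by nra.
    assert (2 * Cmod tau * (1 - T * T) <= R0 * Cmod (1 - tau * tau) * (1 - T * T))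
      by (apply Rmult_le_compat_r; lra).
    replace (R0 * Cmod (1 - tau * tau) * (1 - T * T))
      with (R0 * (1 - T * T) * Cmod (1 - tau * tau)) in H1 by ring.
    rewrite E0 in H1. lra. }
  assert (Hc2 : Cmod tau * Cmod tau * ((1 - T * T) * (1 - T * T))
    <= T * T * (Cmod (1 - tau * tau) * Cmod (1 - tau * tau))).
  { pose proof (Cmod_ge_0 tau). assert (0 < 1 - T * T) by nra.
    assert (0 <= Cmod tau * (1 - T * T)) by nra.
    pose proof (Rmult_le_compat _ _ _ _ H1 H1 Hc Hc). lra. }
  assert (Ht2 : Cmod tau * Cmod tau < 1) by (pose proof (Cmod_ge_0 tau); nra).
  rewrite !Cmod_sq in Hc2. rewrite Cmod_sq in Ht2.
  apply Cmod_le_of_sq; [lra|].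
  clear Etau Ht1 Hc. destruct tau as [x y]. simpl in *.
  eapply Rle_trans; [|apply (radius_Delta_aux x y T HT Ht2)].
  + right. ring.
  + eapply Rle_trans; [exact Hc2|]. right. ring.
- unfold s. replace (1 + 0 * 0)%C with (RtoC 1) by ring. rewrite Csqrt_1.
  replace ((1 + 1) / 2)%C with (RtoC 1) by field. rewrite Clog_1. ring.
- intros z Hz.
  apply (cderiv_eq _ _ (1 + (2 * z / (2 * s z) - 0 - 2 * z / (2 * s z) / (1 + s z)))).
  + field. auto.
  + apply (cderiv_plus (fun w => w)); [apply cderiv_id|].
    apply cderiv_minus; [apply cderiv_minus; [auto|apply cderiv_const]|].
    apply cderiv_log_half_1_plus; auto.
- intros z Hz. unfold psi_Delta. fold (s z).
  replace (z + s z - 1)%C with (z + (s z - 1))%C by ring. rewrite Hq by assumption. ring.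
- apply Rabs_pos_eq. lra.
- unfold psi_Delta. rewrite <- RtoC_mult, <- !RtoC_plus.
  rewrite Csqrt_RtoC by nra. rewrite <- RtoC_plus. f_equal.
  replace (1 + R0 * R0) with ((1 + a - R0) * (1 + a - R0)) by (unfold R0; field; lra).
  rewrite sqrt_square by nra. ring.
Qed.


(** * The classes BS(alpha) *)

Lemma Cmod_1_minus_scal_sq_ge (alpha r : R) (z : C) : 0 <= alpha -> Cmod z <= r ->
  1 - alpha * (r * r) <= Cmod (1 - RtoC alpha * (z * z)).
Proof.
intros Ha Hr. pose proof (Cmod_ge_0 z).
pose proof (Cmod_le_add_minus 1 (RtoC alpha * (z * z))) as T.
rewrite !Cmod_mult, Cmod_1, Cmod_R, Rabs_pos_eq in T by assumption.
assert (Cmod z * Cmod z <= r * r) by nra. nra.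
Qed.

(** The equation for R0 is R0 / (1 - alpha R0^2) = a without denominator. Q is left open because its
    closed form divides by sqrt alpha, so alpha = 0 requires another one. *)
Lemma radius_BS_of_primitive (alpha R0 : R) (Q : C -> C) :
  0 <= alpha <= 1 -> 0 < R0 -> alpha * arcsinh 1 * (R0 * R0) + R0 = arcsinh 1 ->
  Q 0 = 0 ->
  (forall z, in_disk z -> cderiv Q z (/ (1 - RtoC alpha * (z * z)))) ->
  is_class_radius S_star_rho (BS_star alpha) R0.
Proof.
intros Hal HR0 E Q0 HQ.
pose proof arcsinh_1_bounds as Ha. set (a := arcsinh 1) in *.
assert (HR : 0 < R0 <= 1).
{ assert (0 <= alpha * a * (R0 * R0)) by (repeat apply Rmult_le_pos; lra). lra. }
assert (N : forall z, in_disk z -> (1 - RtoC alpha * (z * z))%C <> 0).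
{ intros z Hz. apply Cmod_gt_0. unfold in_disk in Hz. pose proof (Cmod_ge_0 z).
  pose proof (Cmod_1_minus_scal_sq_ge alpha (Cmod z) z ltac:(lra) ltac:(lra)).
  assert (Cmod z * Cmod z < 1) by nra. nra. }
assert (HP : 0 < 1 - alpha * (R0 * R0)).
{ assert (P : a * (1 - alpha * (R0 * R0)) = R0) by lra. nra. }
set (q := fun z => (/ (1 - RtoC alpha * (z * z)))%C).
assert (Hq : forall z, in_disk z -> (z * q z)%C = (psi_BS alpha z - 1)%C)
  by (intros z Hz; unfold q, psi_BS; field; auto).
apply (is_class_radius_of_extremal (psi_BS alpha) Q q (BS_star alpha) R0 R0 a); auto.
- split.
  + apply (class_A_exp_extremal (psi_BS alpha) Q q); auto.
  + apply (quotient_subordinate_exp_extremal (psi_BS alpha) Q q); auto.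
- intros z Hz. eexists. unfold psi_BS.
  apply (cderiv_plus (fun _ => RtoC 1)); [apply cderiv_const|].
  apply (cderiv_div (fun w => w) (fun w => 1 - RtoC alpha * (w * w))%C); [auto|apply cderiv_id|].
  apply cderiv_minus; [apply cderiv_const|]. apply cderiv_scal.
  apply (cderiv_mult (fun w => w) (fun w => w)); apply cderiv_id.
- intros z Hz HzR. fold a. unfold psi_BS.
  replace (1 + z / (1 - RtoC alpha * (z * z)) - 1)%C
    with (z / (1 - RtoC alpha * (z * z)))%C by ring.
  assert (Ek : a / R0 * (1 - alpha * (R0 * R0)) = 1).
  { replace (a / R0 * (1 - alpha * (R0 * R0))) with ((a - alpha * a * (R0 * R0)) / R0)
      by (field; lra).
    replace (a - alpha * a * (R0 * R0)) with R0 by lra. field. lra. }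
  apply (Cmod_div_le _ _ (1 - alpha * (R0 * R0))).
  + exact HP.
  + apply Cmod_1_minus_scal_sq_ge; lra.
  + right. rewrite <- (Rmult_1_l (/ _)), <- Ek at 1. field. lra.
- apply Rabs_pos_eq. lra.
- unfold psi_BS.
  rewrite <- !RtoC_mult, <- RtoC_minus, <- RtoC_div by lra.
  do 2 f_equal.
  apply Rmult_eq_reg_r with (1 - alpha * (R0 * R0)); [|lra].
  unfold Rdiv. rewrite Rmult_assoc, Rinv_l by lra. lra.
Qed.

Lemma radius_BS (alpha : R) : 0 <= alpha <= 1 ->
  is_class_radius S_star_rho (BS_star alpha)
    (if Req_EM_T alpha 0 then arcsinh 1
     else (- 1 + sqrt (1 + alpha * (2 * arcsinh 1) ^ 2)) / (2 * alpha * arcsinh 1)).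
Proof.
intros Hal. pose proof arcsinh_1_bounds as Ha. set (a := arcsinh 1) in *.
destruct (Req_EM_T alpha 0) as [->|Nal].
- apply (radius_BS_of_primitive 0 a (fun z => z)); fold a; auto; try lra.
  intros z _. apply (cderiv_eq _ _ 1); [|apply cderiv_id].
  replace (1 - 0 * (z * z))%C with (RtoC 1) by ring. field.
- set (D := sqrt (1 + alpha * (2 * a) ^ 2)).
  set (be := sqrt alpha).
  assert (Hbe : 0 < be) by (apply sqrt_lt_R0; lra).
  assert (Ebe : be * be = alpha) by (apply sqrt_sqrt; lra).
  assert (Nbe : RtoC be <> 0) by now apply RtoC_neq_0.
  assert (Hre : forall s z, Rabs s <= 1 -> in_disk z -> 0 < Re (1 + RtoC s * z)%C).
  { intros s z Hs Hz. rewrite Re_plus. simpl (Re 1).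
    pose proof (Re_le_Cmod (RtoC s * z)) as H. rewrite Cmod_mult, Cmod_R in H.
    unfold in_disk in Hz. pose proof (Cmod_ge_0 z). pose proof (Rabs_pos s).
    assert (Rabs s * Cmod z < 1) by nra. lra. }
  assert (Hbe1 : be <= 1) by nra.
  assert (Hre1 : forall z, in_disk z -> 0 < Re (1 + RtoC be * z)%C).
  { intros z. apply Hre. rewrite Rabs_pos_eq; lra. }
  assert (Hre2 : forall z, in_disk z -> 0 < Re (1 + RtoC (- be) * z)%C).
  { intros z. apply Hre. rewrite Rabs_Ropp, Rabs_pos_eq; lra. }
  clear Hre.
  assert (Hl : forall s z, cderiv (fun w => 1 + RtoC s * w)%C z (RtoC s)).
  { intros s z. apply (cderiv_eq _ _ (0 + RtoC s * 1)); [ring|].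
    apply (cderiv_plus (fun _ => RtoC 1)); [apply cderiv_const|]. apply cderiv_scal, cderiv_id. }
  assert (HD : D * D = 1 + 4 * alpha * (a * a)).
  { unfold D. rewrite sqrt_sqrt; [ring|]. nra. }
  assert (HD1 : 1 < D).
  { pose proof (sqrt_pos (1 + alpha * (2 * a) ^ 2)) as H. fold D in H.
    assert (0 < alpha * (a * a)) by (apply Rmult_lt_0_compat; nra). nra. }
  (* This is artanh (be z) / be, written as a difference of logarithms so that both arguments have
     positive real part. *)
  apply (radius_BS_of_primitive alpha _
    (fun z => / (2 * RtoC be) *
       (Clog (1 + RtoC be * z) - Clog (1 + RtoC (- be) * z)))%C); auto.
  + apply Rdiv_lt_0_compat; [lra|]. repeat apply Rmult_lt_0_compat; lra.
  + fold a.
    replace (alpha * a * ((-1 + D) / (2 * alpha * a) * ((-1 + D) / (2 * alpha * a)))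
             + (-1 + D) / (2 * alpha * a))
      with ((D * D - 1) / (4 * alpha * a)) by (field; lra).
    rewrite HD. field. lra.
  + replace (1 + RtoC be * 0)%C with (RtoC 1) by ring.
    replace (1 + RtoC (- be) * 0)%C with (RtoC 1) by ring. ring.
  + intros z Hz.
    pose proof (Re_gt_0_neq_0 _ (Hre1 z Hz)) as N1.
    pose proof (Re_gt_0_neq_0 _ (Hre2 z Hz)) as N2.
    apply (cderiv_eq _ _ (/ (2 * RtoC be) *
      (RtoC be / (1 + RtoC be * z) - RtoC (- be) / (1 + RtoC (- be) * z)))).
    * rewrite <- Ebe, RtoC_mult. rewrite RtoC_opp in *.
      replace (1 - RtoC be * RtoC be * (z * z))%C
        with ((1 + RtoC be * z) * (1 + - RtoC be * z))%C by ring.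
      field. auto.
    * apply cderiv_scal. apply cderiv_minus.
      -- apply (cderiv_Clog_comp (fun w => 1 + RtoC be * w)%C); auto.
      -- apply (cderiv_Clog_comp (fun w => 1 + RtoC (- be) * w)%C); auto.
Qed.

(** * The exponential class *)

(** |exp z - 1|^2 = (exp x - 1)^2 + 2 exp x (1 - cos y) <= exp x (4 sinh^2 (x/2) + y^2). By
    [sinh_sq_minus_sq_le] at x/2 and |z|/2 the bracket is at most 4 sinh^2 (|z|/2). *)
Lemma Cmod_Cexp_minus_1_le (z : C) : Cmod (Cexp z - 1) <= exp (Cmod z) - 1.
Proof.
assert (P : forall x, (exp x - 1) * (exp x - 1) = exp x * (4 * (sinh (x / 2) * sinh (x / 2)))).
{ intros x. unfold sinh. set (u := exp (x / 2)).
  assert (E1 : exp x = u * u) by (unfold u; rewrite <- exp_plus; f_equal; field).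
  assert (E2 : u * exp (- (x / 2)) = 1).
  { unfold u. rewrite <- exp_plus, Rplus_opp_r. apply exp_0. }
  rewrite E1. set (v := exp (- (x / 2))) in *.
  replace (u * u * (4 * ((u - v) / 2 * ((u - v) / 2))))
    with ((u * u - u * v) * (u * u - u * v)) by field.
  now rewrite E2. }
pose proof (Cmod_ge_0 z) as H0. pose proof (exp_ineq1_le (Cmod z)).
apply Cmod_le_of_sq; [lra|]. rewrite P.
assert (Hx : exp (Re z) <= exp (Cmod z)).
{ pose proof (Re_le_Cmod z) as H1. destruct (Rle_lt_or_eq_dec _ _ (proj2 H1)) as [H2|H2].
  - left. now apply exp_increasing.
  - right. now rewrite H2. }
pose proof (exp_pos (Re z)).
assert (Hh : Rabs (Re z / 2) <= Cmod z / 2).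
{ unfold Rdiv. rewrite Rabs_mult, (Rabs_pos_eq (/ 2)) by lra.
  pose proof (Rabs_Re_le z). lra. }
pose proof (sinh_sq_minus_sq_le _ _ Hh) as Hs.
pose proof (cos_ge_quadratic (Im z)) as Hc. pose proof (Cmod_sq z) as Hq.
pose proof (sin2_cos2 (Im z)) as Hsc. unfold Rsqr in Hsc.
unfold Cexp. simpl.
replace ((exp (Re z) * cos (Im z) + - (1)) * (exp (Re z) * cos (Im z) + - (1)) +
  (exp (Re z) * sin (Im z) + - 0) * (exp (Re z) * sin (Im z) + - 0))
  with (exp (Re z) * exp (Re z) * (sin (Im z) * sin (Im z) + cos (Im z) * cos (Im z))
        + 1 - 2 * exp (Re z) * cos (Im z)) by ring.
rewrite Hsc.
apply Rle_trans with (exp (Re z) * (4 * (sinh (Cmod z / 2) * sinh (Cmod z / 2)))).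
- pose proof (P (Re z)) as PR.
  apply Rle_trans with ((exp (Re z) - 1) * (exp (Re z) - 1)
    + exp (Re z) * (Im z * Im z)); [nra|].
  rewrite PR, <- Rmult_plus_distr_l. apply Rmult_le_compat_l; lra.
- apply Rmult_le_compat_r; [|exact Hx]. nra.
Qed.

Definition is_Cint (f : R -> C) (l : C) : Prop :=
  is_RInt (fun t => Re (f t)) 0 1 (Re l) /\ is_RInt (fun t => Im (f t)) 0 1 (Im l).

Lemma is_Cint_ext (f g : R -> C) (l : C) :
  (forall t, f t = g t) -> is_Cint f l -> is_Cint g l.
Proof.
intros E [H1 H2].
split; [apply (is_RInt_ext (fun t => Re (f t)))|apply (is_RInt_ext (fun t => Im (f t)))];
  auto; intros; now rewrite E.
Qed.

Lemma is_Cint_minus (f g : R -> C) (l m : C) :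
  is_Cint f l -> is_Cint g m -> is_Cint (fun t => f t - g t)%C (l - m).
Proof.
intros [F1 F2] [G1 G2]. split.
- exact (is_RInt_minus _ _ _ _ _ _ F1 G1).
- exact (is_RInt_minus _ _ _ _ _ _ F2 G2).
Qed.

Lemma is_Cint_scal (k : C) (f : R -> C) (l : C) :
  is_Cint f l -> is_Cint (fun t => k * f t)%C (k * l).
Proof.
intros [F1 F2]. split.
- exact (is_RInt_minus _ _ _ _ _ _ (is_RInt_scal _ _ _ (Re k) _ F1)
                                    (is_RInt_scal _ _ _ (Im k) _ F2)).
- exact (is_RInt_plus _ _ _ _ _ _ (is_RInt_scal _ _ _ (Re k) _ F2)
                                   (is_RInt_scal _ _ _ (Im k) _ F1)).
Qed.

(** The factor 2 comes from bounding the coordinates separately. It does no harm: the bound serves a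
    second-order remainder and an integral that is zero. *)
Lemma is_Cint_Cmod_le (f : R -> C) (l : C) (M : R) :
  (forall t, 0 <= t <= 1 -> Cmod (f t) <= M) -> is_Cint f l -> Cmod l <= 2 * M.
Proof.
intros H [F1 F2]. eapply Rle_trans; [apply Cmod_le_parts|].
assert (Rabs (Re l) <= (1 - 0) * M).
{ apply (norm_RInt_le_const (fun t => Re (f t)) 0 1 (Re l) M); [lra| |exact F1].
  intros t Ht. eapply Rle_trans; [apply Rabs_Re_le|now apply H]. }
assert (Rabs (Im l) <= (1 - 0) * M).
{ apply (norm_RInt_le_const (fun t => Im (f t)) 0 1 (Im l) M); [lra| |exact F2].
  intros t Ht. eapply Rle_trans; [apply Rabs_Im_le|now apply H]. }
lra.
Qed.

Definition Ccontinuous (f : C -> C) (z : C) : Prop :=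
  forall eps, 0 < eps -> exists d, 0 < d /\
    forall w, Cmod (w - z) < d -> Cmod (f w - f z) < eps.

Lemma continuous_segment (f : C -> C) (z k : C) (t : R) : Ccontinuous f (RtoC t * z) ->
  continuous (fun s : R => Re (k * f (RtoC s * z)%C)%C) t /\
  continuous (fun s : R => Im (k * f (RtoC s * z)%C)%C) t.
Proof.
intros H.
assert (P : forall eps : posreal, locally t (fun s : R =>
  Cmod (k * f (RtoC s * z)%C - k * f (RtoC t * z)%C) < eps)).
{ intros eps. pose proof (Cmod_ge_0 k). pose proof (Cmod_ge_0 z). pose proof (cond_pos eps).
  destruct (H (eps / (Cmod k + 1))) as [d [Hd Hw]]; [apply Rdiv_lt_0_compat; lra|].
  assert (Hd' : 0 < d / (Cmod z + 1)) by (apply Rdiv_lt_0_compat; lra).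
  exists (mkposreal _ Hd'). intros s Hs. change (Rabs (s - t) < d / (Cmod z + 1)) in Hs.
  assert (Hm : Cmod (RtoC s * z - RtoC t * z) < d).
  { replace (RtoC s * z - RtoC t * z)%C with (RtoC (s - t) * z)%C
      by (rewrite RtoC_minus; ring).
    rewrite Cmod_mult, Cmod_R.
    apply Rle_lt_trans with (Rabs (s - t) * (Cmod z + 1)).
    - apply Rmult_le_compat_l; [apply Rabs_pos|lra].
    - replace d with (d / (Cmod z + 1) * (Cmod z + 1)) by (field; lra).
      apply Rmult_lt_compat_r; lra. }
  specialize (Hw _ Hm).
  replace (k * f (RtoC s * z)%C - k * f (RtoC t * z)%C)%C
    with (k * (f (RtoC s * z)%C - f (RtoC t * z)%C))%C by ring.
  rewrite Cmod_mult.
  apply Rle_lt_trans with ((Cmod k + 1) * Cmod (f (RtoC s * z)%C - f (RtoC t * z)%C)%C).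
  - apply Rmult_le_compat_r; [apply Cmod_ge_0|lra].
  - replace (pos eps) with ((Cmod k + 1) * (eps / (Cmod k + 1))) by (field; lra).
    apply Rmult_lt_compat_l; lra. }
split; apply filterlim_locally; intros eps;
  refine (filter_imp _ _ _ (P eps)); intros s Hs; refine (Rle_lt_trans _ _ _ _ Hs).
- exact (Rabs_Re_le (k * f (RtoC s * z) - k * f (RtoC t * z))%C).
- exact (Rabs_Im_le (k * f (RtoC s * z) - k * f (RtoC t * z))%C).
Qed.

Definition Cexpm1_div (w : C) : C := if Ceq_dec w 0 then 1 else ((Cexp w - 1) / w)%C.

Lemma Cexpm1_div_mult (w : C) : (w * Cexpm1_div w)%C = (Cexp w - 1)%C.
Proof.
unfold Cexpm1_div. destruct (Ceq_dec w 0) as [->|N].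
- rewrite Cexp_0. ring.
- field. assumption.
Qed.

Lemma Cexpm1_div_continuous (w : C) : Ccontinuous Cexpm1_div w.
Proof.
destruct (Ceq_dec w 0) as [->|N].
- intros eps Heps. exists (Rmin (/ 2) (eps / 3)). split; [apply Rmin_glb_lt; lra|].
  intros w Hw. replace (w - 0)%C with w in Hw by ring.
  pose proof (Rmin_l (/ 2) (eps / 3)). pose proof (Rmin_r (/ 2) (eps / 3)).
  unfold Cexpm1_div at 2. destruct (Ceq_dec 0 0) as [_|C]; [|congruence].
  unfold Cexpm1_div. destruct (Ceq_dec w 0) as [->|Nw].
  + replace (1 - 1)%C with (RtoC 0) by ring. now rewrite Cmod_0.
  + pose proof (proj1 (Cmod_gt_0 w) Nw).
    replace ((Cexp w - 1) / w - 1)%C with ((Cexp w - 1 - w) / w)%C by (field; assumption).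
    rewrite Cmod_div by assumption.
    apply Rmult_lt_reg_r with (Cmod w); [assumption|].
    unfold Rdiv. rewrite Rmult_assoc, Rinv_l, Rmult_1_r by lra.
    eapply Rle_lt_trans; [apply Cexp_minus_affine_le; lra|]. nra.
- pose proof (proj1 (Cmod_gt_0 w) N).
  assert (D : exists l, cderiv Cexpm1_div w l).
  { eexists. apply (cderiv_ext_loc (fun w => (Cexp w - 1) / w)%C _ _ _ (Cmod w)); [assumption| |].
    - intros v Hv. unfold Cexpm1_div. destruct (Ceq_dec v 0) as [->|]; [|reflexivity].
      exfalso. rewrite Cmod_minus_sym in Hv. replace (w - 0)%C with w in Hv by ring. lra.
    - apply (cderiv_div (fun w => Cexp w - 1)%C (fun w => w)); [assumption| |apply cderiv_id].
      apply cderiv_minus; [apply cderiv_Cexp|apply cderiv_const]. }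
  destruct D as [l D]. exact (cderiv_continuous _ _ _ D).
Qed.

(** exp (t z) is the z-derivative of the integrand of [Ein], so this integral is the expected
    derivative of [Ein]. *)
Lemma is_Cint_Cexp (z : C) : is_Cint (fun t => Cexp (RtoC t * z)) (Cexpm1_div z).
Proof.
assert (P : is_Cint (fun t => z * Cexp (RtoC t * z))%C (Cexp z - 1)).
{ assert (D : forall k t, is_derive (fun s : R => Re (Cexp (0 + RtoC s * z) * k)%C) t
                            (Re (Cexp (0 + RtoC t * z) * z * k)%C))
    by (intros; apply is_derive_Re_path, cderiv_Cexp).
  assert (HC : forall w, Ccontinuous Cexp w)
    by (intros w; exact (cderiv_continuous _ _ _ (cderiv_Cexp w))).
  split.
  - replace (Re (Cexp z - 1)%C)
      with (minus (Re (Cexp (0 + RtoC 1 * z) * 1)%C) (Re (Cexp (0 + RtoC 0 * z) * 1)%C)).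
    + apply (is_RInt_derive (fun s : R => Re (Cexp (0 + RtoC s * z) * 1)%C)).
      * intros t _. evar_last; [apply D|].
        replace (0 + RtoC t * z)%C with (RtoC t * z)%C by ring. f_equal. ring.
      * intros t _. exact (proj1 (continuous_segment Cexp z z t (HC _))).
    + replace (0 + RtoC 1 * z)%C with z by ring. replace (0 + RtoC 0 * z)%C with (RtoC 0) by ring.
      rewrite Cexp_0. unfold minus, plus, opp. simpl. ring.
  - replace (Im (Cexp z - 1)%C)
      with (minus (Re (Cexp (0 + RtoC 1 * z) * - Ci)%C) (Re (Cexp (0 + RtoC 0 * z) * - Ci)%C)).
    + apply (is_RInt_derive (fun s : R => Re (Cexp (0 + RtoC s * z) * - Ci)%C)).
      * intros t _. evar_last; [apply D|].
        replace (0 + RtoC t * z)%C with (RtoC t * z)%C by ring.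
        rewrite (Cmult_comm z). set (v := (Cexp _ * z)%C). destruct v as [x y]. simpl. ring.
      * intros t _. exact (proj2 (continuous_segment Cexp z z t (HC _))).
    + replace (0 + RtoC 1 * z)%C with z by ring. replace (0 + RtoC 0 * z)%C with (RtoC 0) by ring.
      rewrite Cexp_0. unfold minus, plus, opp. simpl. ring. }
destruct (Ceq_dec z 0) as [->|N].
- replace (Cexpm1_div 0) with (RtoC 1)
    by (unfold Cexpm1_div; destruct (Ceq_dec 0 0); congruence).
  apply (is_Cint_ext (fun _ => RtoC 1)).
  + intros t. replace (RtoC t * 0)%C with (RtoC 0) by ring. now rewrite Cexp_0.
  + split; simpl; evar_last; try apply @is_RInt_const; unfold scal; simpl; unfold mult; simpl; ring.
- apply (is_Cint_ext (fun t => / z * (z * Cexp (RtoC t * z)))%C);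
    [intros; field; assumption|].
  replace (Cexpm1_div z) with (/ z * (Cexp z - 1))%C.
  + now apply is_Cint_scal.
  + rewrite <- Cexpm1_div_mult. field. assumption.
Qed.

(* [int_0^z (exp w - 1) / w dw] *)
Definition Ein (z : C) : C :=
  (RInt (fun t => Re (z * Cexpm1_div (RtoC t * z))%C) 0 1,
   RInt (fun t => Im (z * Cexpm1_div (RtoC t * z))%C) 0 1).

Lemma is_Cint_Ein (z : C) : is_Cint (fun t => z * Cexpm1_div (RtoC t * z))%C (Ein z).
Proof.
assert (H := fun t => continuous_segment Cexpm1_div z z t (Cexpm1_div_continuous _)).
split; apply (@RInt_correct R_CompleteNormedModule);
  apply (@ex_RInt_continuous R_CompleteNormedModule); intros t _.
- exact (proj1 (H t)).
- exact (proj2 (H t)).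
Qed.

Lemma Ein_0 : Ein 0 = 0.
Proof.
apply Cmod_eq_0. apply Rle_antisym; [|apply Cmod_ge_0].
apply Rle_trans with (2 * 0); [|lra].
apply (fun H => is_Cint_Cmod_le _ _ 0 H (is_Cint_Ein 0)). intros t _.
replace (0 * Cexpm1_div (RtoC t * 0))%C with (RtoC 0) by ring. rewrite Cmod_0. lra.
Qed.

(** Multiplied by t, the remainder of the integrand collapses to exp (t z) (exp (t h) - 1 - t h), of
    size at most 3 exp |z| t^2 |h|^2. Dividing by t leaves a uniform bound; t = 0 is treated
    apart. *)
Lemma cderiv_Ein (z : C) : cderiv Ein z (Cexpm1_div z).
Proof.
apply (cderiv_quadratic _ _ _ (2 * (3 * exp (Cmod z))) (/ 2)); [lra|]. intros w Hw.
set (h := (w - z)%C) in *.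
rewrite Rmult_assoc.
apply (is_Cint_Cmod_le (fun t =>
  w * Cexpm1_div (RtoC t * w) - z * Cexpm1_div (RtoC t * z) - h * Cexp (RtoC t * z))%C).
- intros t Ht. pose proof (exp_pos (Cmod z)) as He. pose proof (Cmod_ge_0 h) as Hh.
  destruct (Req_dec t 0) as [->|Nt].
  + replace (RtoC 0 * w)%C with (RtoC 0) by ring. replace (RtoC 0 * z)%C with (RtoC 0) by ring.
    unfold Cexpm1_div. destruct (Ceq_dec 0 0); [|congruence]. rewrite Cexp_0.
    replace (w * 1 - z * 1 - h * 1)%C with (RtoC 0) by (unfold h; ring).
    rewrite Cmod_0. apply Rmult_le_pos; nra.
  + apply Rmult_le_reg_l with t; [lra|].
    replace (t * Cmod (w * Cexpm1_div (RtoC t * w) - z * Cexpm1_div (RtoC t * z)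
                       - h * Cexp (RtoC t * z)))
      with (Cmod (Cexp (RtoC t * z) * (Cexp (RtoC t * h) - 1 - RtoC t * h))).
    2: { rewrite <- Cmod_RtoC_mult by lra. f_equal.
      replace (RtoC t * (w * Cexpm1_div (RtoC t * w) - z * Cexpm1_div (RtoC t * z)
                         - h * Cexp (RtoC t * z)))%C
        with (RtoC t * w * Cexpm1_div (RtoC t * w) - RtoC t * z * Cexpm1_div (RtoC t * z)
              - RtoC t * h * Cexp (RtoC t * z))%C by ring.
      rewrite !Cexpm1_div_mult.
      replace (RtoC t * w)%C with (RtoC t * z + RtoC t * h)%C by (unfold h; ring).
      rewrite Cexp_plus. ring. }
    rewrite Cmod_mult, Cmod_Cexp.
    assert (Hth : Cmod (RtoC t * h) = t * Cmod h) by (apply Cmod_RtoC_mult; lra).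
    pose proof (Cexp_minus_affine_le (RtoC t * h) ltac:(rewrite Hth; nra)) as H.
    rewrite Hth in H.
    assert (Hexp : exp (Re (RtoC t * z)%C) <= exp (Cmod z)).
    { assert (Hle : Re (RtoC t * z)%C <= Cmod z).
      { rewrite Re_RtoC_mult. pose proof (Re_le_Cmod z). pose proof (Cmod_ge_0 z). nra. }
      destruct Hle as [Hlt|Heq]; [left; now apply exp_increasing|right; now rewrite Heq]. }
    apply Rle_trans with (exp (Cmod z) * (3 * (t * Cmod h * (t * Cmod h)))).
    * apply Rmult_le_compat; [left; apply exp_pos|apply Cmod_ge_0|assumption|assumption].
    * replace (t * (3 * exp (Cmod z) * (Cmod h * Cmod h)))
        with (exp (Cmod z) * (3 * (t * (Cmod h * Cmod h)))) by ring.
      apply Rmult_le_compat_l; [lra|]. apply Rmult_le_compat_l; [lra|].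
      assert (0 <= t * (Cmod h * Cmod h)) by (apply Rmult_le_pos; nra). nra.
- rewrite (Cmult_comm _ h). apply is_Cint_minus; [apply is_Cint_minus; apply is_Cint_Ein|].
  apply is_Cint_scal, is_Cint_Cexp.
Qed.

(** After passing to exp |z| - 1, the linear bound is the chord of this convex function over
    [0, R0], of slope a / R0. *)
Lemma radius_e : is_class_radius S_star_rho S_star_e (ln (1 + arcsinh 1)).
Proof.
pose proof arcsinh_1_bounds as Ha. set (a := arcsinh 1) in *.
set (R0 := ln (1 + a)).
assert (E : exp R0 = 1 + a) by (apply exp_ln; lra).
assert (HR : 0 < R0 <= 1).
{ split.
  - apply exp_lt_inv. rewrite E, exp_0. lra.
  - pose proof (exp_ineq1_le R0). lra. }
apply (S_star_radius_of_extremal psi_e Ein Cexpm1_div R0 R0 a); auto.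
- intros z Hz. unfold in_disk in Hz. unfold psi_e, Cexp. simpl.
  apply Rmult_lt_0_compat; [apply exp_pos|]. pose proof PI2_1.
  pose proof (Rabs_Im_le z) as H1. apply Rabs_le_between in H1. apply cos_gt_0; lra.
- intros z _. eexists. apply cderiv_Cexp.
- intros z Hz HzR. fold a. pose proof (Cmod_ge_0 z).
  eapply Rle_trans; [apply Cmod_Cexp_minus_1_le|].
  pose proof (le_chord (fun x => exp x - 1) exp (Cmod z) R0 ltac:(lra)) as P.
  cbv beta in P. rewrite E in P.
  apply Rmult_le_reg_r with R0; [lra|].
  replace (a / R0 * Cmod z * R0) with (Cmod z * (1 + a - 1)) by (field; lra).
  apply P.
  + rewrite exp_0. ring.
  + intros x _. auto_derive; [trivial|ring].
  + intros x y [_ [Hxy|Hxy]]; [left; now apply exp_increasing|right; now rewrite Hxy].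
- apply Ein_0.
- intros z _. apply cderiv_Ein.
- intros z _. apply Cexpm1_div_mult.
- apply Rabs_pos_eq. lra.
- unfold psi_e. rewrite Cexp_RtoC, E. apply RtoC_plus.
Qed.


(** * The class RL *)

Lemma Re_div_gt_0 (u v : C) : v <> 0 -> 0 < Re u * Re v + Im u * Im v -> 0 < Re (u / v)%C.
Proof.
intros N H. pose proof (proj1 (Cmod_gt_0 v) N) as P. pose proof (Cmod_sq v) as Q.
replace (Re (u / v)%C) with ((Re u * Re v + Im u * Im v) / (Cmod v * Cmod v)).
- apply Rdiv_lt_0_compat; nra.
- rewrite Q. assert (Re v * Re v + Im v * Im v <> 0) by nra.
  destruct u, v. simpl in *. field. simpl. lra.
Qed.

(* [|1 + b p^2| <= A |1 + p|] for [p = x + i y] with [0 <= x] and [|p| <= S]. *)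
Lemma radius_RL_aux (b S A x y : R) :
  0.8284 <= b <= 0.8285 -> 3.127 <= S <= 3.129 -> A * (1 + S) = 1 + b * (S * S) ->
  0 <= x -> x * x + y * y <= S * S ->
  (1 + b * (x * x - y * y)) * (1 + b * (x * x - y * y)) + 2 * b * x * y * (2 * b * x * y)
    <= A * A * ((1 + x) * (1 + x) + y * y).
Proof.
intros Hb HS EA Hx Hv.
set (v := x * x + y * y) in *.
assert (Hv0 : 0 <= v) by (unfold v; nra).
set (t := sqrt v).
assert (Et : t * t = v) by now apply sqrt_sqrt.
assert (Ht0 : 0 <= t) by apply sqrt_pos.
assert (Hxt : x <= t) by (unfold v in Et; nra).
assert (HtS : t <= S) by nra.
assert (HSS : 9.778 <= S * S <= 9.791) by nra.
assert (HA : 2.204 <= A) by nra.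
(* [F] is concave, so it suffices to look at the end points [0] and [t]. *)
set (F := fun x => A * A * (1 + 2 * x + v) - 1 - 4 * b * (x * x) + 2 * b * v - b * b * (v * v)).
assert (F0 : 0 <= F 0).
{ unfold F.
  (* F 0 times S^2 is split along v and S^2 - v. The tight coefficient is A^2 (1 + S^2) - (b S^2 -
     1)^2, at worst about 52.3 against 50.7; hence the narrow ranges for b and S. *)
  assert (E : (A * A * (1 + 2 * 0 + v) - 1 - 4 * b * (0 * 0) + 2 * b * v - b * b * (v * v))
    * (S * S) = (S * S - v) * (A * A - 1)
     + v * (A * A * (1 + S * S) - (b * (S * S) - 1) * (b * (S * S) - 1))
     + b * b * v * (S * S - v) * (S * S)) by ring.
  assert (4.857 <= A * A) by nra.
  assert (0 <= A * A * (1 + S * S) - (b * (S * S) - 1) * (b * (S * S) - 1)).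
  { assert (7 <= b * (S * S) - 1 <= 7.12) by nra. nra. }
  assert (0 <= (S * S - v) * (A * A - 1)) by (apply Rmult_le_pos; lra).
  assert (0 <= v * (A * A * (1 + S * S) - (b * (S * S) - 1) * (b * (S * S) - 1)))
    by (apply Rmult_le_pos; lra).
  assert (0 <= b * b * v * (S * S - v) * (S * S)) by (repeat apply Rmult_le_pos; lra).
  nra. }
(* x = t is the case of real p. There F is a difference of squares, and its first factor times S is
   (S - t) (b t S + A - 1), which vanishes at the extremal p = S. *)
assert (Ft : 0 <= F t).
{ unfold F. rewrite Et.
  replace (A * A * (1 + 2 * t + v) - 1 - 4 * b * v + 2 * b * v - b * b * (v * v))
    with ((A * (1 + t) - (1 + b * v)) * (A * (1 + t) + (1 + b * v))) by (rewrite <- Et; ring).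
  assert (E : (A * (1 + t) - (1 + b * v)) * S = (S - t) * (b * t * S + (A - 1))).
  { rewrite <- Et. replace (A * (1 + t)) with (A * (1 + S) + A * t - A * S) by ring.
    transitivity ((1 + b * (S * S) + A * t - A * S - (1 + b * (t * t))) * S).
    - now rewrite EA.
    - replace (A * t) with (A * S - A * (S - t)) by ring.
      assert (K : A * S = 1 + b * (S * S) - A) by lra.
      replace ((1 + b * (S * S) + (A * S - A * (S - t)) - A * S - (1 + b * (t * t))) * S)
        with ((S - t) * (b * (S + t) * S - A * S)) by ring.
      rewrite K. ring. }
  assert (0 <= (S - t) * (b * t * S + (A - 1))).
  { apply Rmult_le_pos; [lra|].
    assert (0 <= b * t * S) by (repeat apply Rmult_le_pos; lra). lra. }
  apply Rmult_le_pos; [nra|]. nra. }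
(* Concavity in exact form: the last term is the excess over the chord. *)
assert (FE : t * F x = (t - x) * F 0 + x * F t + 4 * b * x * t * (t - x)) by (unfold F; ring).
assert (HF : 0 <= F x).
{ destruct (Req_dec t 0) as [T0|T0].
  - assert (x = 0) by lra. now subst x.
  - assert (0 <= (t - x) * F 0) by (apply Rmult_le_pos; lra).
    assert (0 <= x * F t) by (apply Rmult_le_pos; lra).
    assert (0 <= 4 * b * x * t * (t - x)) by (repeat apply Rmult_le_pos; lra).
    nra. }
unfold F, v in HF. lra.
Qed.

Lemma radius_RL : is_class_radius S_star_rho S_star_RL
  ((2 + (1 + sqrt 2) * arcsinh 1) * arcsinh 1
   / (5 - 3 * sqrt 2 + (4 * (sqrt 2 - 1) + 2 * arcsinh 1) * arcsinh 1)).
Proof.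
pose proof arcsinh_1_bounds as Ha. pose proof sqrt_2_bounds as Hr.
pose proof (sqrt_sqrt 2 ltac:(lra)) as Er.
set (a := arcsinh 1) in *.
set (R0 := (2 + (1 + sqrt 2) * a) * a / (5 - 3 * sqrt 2 + (4 * (sqrt 2 - 1) + 2 * a) * a)).
set (c := sqrt 2 - 1). set (b := 2 * c).
assert (Hc : 0.4142 <= c <= 0.41425) by (unfold c; lra).
assert (Hb : 0.8284 <= b <= 0.8285) by (unfold b; lra).
assert (Ec : c * (sqrt 2 + 1) = 1) by (unfold c; lra).
assert (Ecb : c * c = 1 - b) by (unfold b, c; lra).
(* S is the value of the square root at z = -R0, solved from 1 + c (1 - S) = 1 - a. [ER] is z = (1 -
   p^2) / (1 + b p^2) at that point. *)
set (S := 1 + a * (sqrt 2 + 1)).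
assert (HS : 3.127 <= S <= 3.129) by (unfold S; split; nra).
assert (EcS : c * (S - 1) = a).
{ unfold S. replace (c * (1 + a * (sqrt 2 + 1) - 1)) with (a * (c * (sqrt 2 + 1))) by ring.
  rewrite Ec. ring. }
assert (ER : R0 * (1 + b * (S * S)) = S * S - 1).
{ set (D := 5 - 3 * sqrt 2 + (4 * (sqrt 2 - 1) + 2 * a) * a) in *.
  assert (HD : 0 < D) by (unfold D; nra).
  assert (E1 : 1 + b * (S * S) = (sqrt 2 + 1) * D).
  { unfold D. replace (1 + b * (S * S)) with
      (1 + 2 * c + 4 * a * (c * (sqrt 2 + 1)) + 2 * (a * a) * (sqrt 2 + 1) * (c * (sqrt 2 + 1)))
      by (unfold S, b; ring).
    rewrite Ec. unfold c.
    replace ((sqrt 2 + 1) * (5 - 3 * sqrt 2 + (4 * (sqrt 2 - 1) + 2 * a) * a))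
      with (5 + 2 * sqrt 2 - 3 * (sqrt 2 * sqrt 2) + 4 * a * (sqrt 2 * sqrt 2) - 4 * a
            + 2 * (a * a) * (sqrt 2 + 1)) by ring.
    rewrite Er. ring. }
  rewrite E1. unfold R0, S. field. lra. }
assert (HSS : 9.778 <= S * S <= 9.791) by nra.
assert (HbS : 8.1 <= b * (S * S)) by nra.
clearbody R0.
assert (HR : 0 < R0 <= 1).
{ set (K := 1 + b * (S * S)) in *. assert (9.1 <= K) by (unfold K; lra).
  clearbody K. split; nra. }
assert (HbR : 0 < 1 - b * R0) by nra.
assert (ES : (1 + R0) = S * S * (1 - b * R0)) by lra.
(* A is the value of (1 + b p^2) / (1 + p) at p = S; the slope a / R0 to be reached is c A. *)
set (A := (1 + b * (S * S)) / (1 + S)).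
assert (EA : A * (1 + S) = 1 + b * (S * S)) by (unfold A; field; lra).
assert (EaR : a / R0 = c * A).
{ apply Rmult_eq_reg_r with (R0 * (1 + S)); [|nra].
  replace (a / R0 * (R0 * (1 + S))) with (a * (1 + S)) by (field; lra).
  replace (c * A * (R0 * (1 + S))) with (c * (R0 * (A * (1 + S)))) by ring.
  rewrite EA, ER, <- EcS. ring. }
set (n := fun z => (1 - z)%C). set (d := fun z => (1 + RtoC b * z)%C).
set (p := fun z => Csqrt (n z / d z)).
assert (Mbz : forall z, Cmod (RtoC b * z) = b * Cmod z)
  by (intros z; apply Cmod_RtoC_mult; lra).
assert (Md : forall z, 1 - b * Cmod z <= Cmod (d z)).
{ intros z. pose proof (Cmod_le_add_minus 1 (d z)) as T. rewrite Cmod_1 in T.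
  replace (1 - d z)%C with (- (RtoC b * z))%C in T by (unfold d; ring).
  rewrite Cmod_opp, Mbz in T. lra. }
assert (Mn : forall z, Cmod (n z) <= 1 + Cmod z).
{ intros z. unfold n. eapply Rle_trans; [apply Cmod_minus_le|]. rewrite Cmod_1. lra. }
assert (Nd : forall z, in_disk z -> d z <> 0).
{ intros z Hz. apply Cmod_gt_0. unfold in_disk in Hz.
  pose proof (Md z). pose proof (Cmod_ge_0 z). nra. }
assert (Hw : forall z, in_disk z -> 0 < Re (n z / d z)%C).
{ intros z Hz. apply Re_div_gt_0; [auto|].
  replace (Re (n z) * Re (d z) + Im (n z) * Im (d z))
    with (1 - (1 - b) * Re z - b * (Re z * Re z + Im z * Im z))
    by (unfold n, d; destruct z; simpl; ring).
  rewrite <- Cmod_sq. pose proof (Re_le_Cmod z). pose proof (Cmod_ge_0 z).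
  unfold in_disk in Hz.
  assert ((1 - b) * Re z <= (1 - b) * Cmod z) by (apply Rmult_le_compat_l; lra).
  assert (0 < (1 - Cmod z) * (1 + b * Cmod z)).
  { apply Rmult_lt_0_compat; [lra|]. pose proof (Rmult_le_pos b (Cmod z)). lra. }
  lra. }
assert (Hp : forall z, in_disk z -> 0 < Re (p z)) by (intros; now apply Re_Csqrt_gt_0, Hw).
assert (Epp : forall z, (p z * p z)%C = (n z / d z)%C) by (intros; apply Csqrt_mult_self).
assert (Mp : forall z, in_disk z -> Cmod (p z) * Cmod (p z) * Cmod (d z) = Cmod (n z)).
{ intros z Hz. rewrite <- Cmod_mult, Epp, <- Cmod_mult. f_equal. field. auto. }
assert (Np : forall z, in_disk z -> p z <> 0) by (intros; now apply Re_gt_0_neq_0, Hp).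
assert (N1 : forall z, in_disk z -> (1 + p z)%C <> 0).
{ intros z Hz. apply Re_gt_0_neq_0. rewrite Re_plus. specialize (Hp z Hz). simpl (Re 1). lra. }
assert (Nb1 : (1 + RtoC b)%C <> 0)
  by (rewrite <- RtoC_plus; apply RtoC_neq_0; lra).
(* As e = (1 + b) / d, one has z e = 1 - p^2, so (psi - 1) / z = c e / (1 + p). *)
set (e := fun z => (1 + RtoC b * (p z * p z))%C).
assert (Ee : forall z, in_disk z -> e z = ((1 + RtoC b) / d z)%C).
{ intros z Hz. unfold e. rewrite Epp.
  transitivity ((d z + RtoC b * n z) / d z)%C; [field; auto|].
  f_equal. unfold d, n. ring. }
assert (Ne : forall z, in_disk z -> e z <> 0).
{ intros z Hz. rewrite Ee by assumption. intros H. apply Nb1.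
  replace (1 + RtoC b)%C with ((1 + RtoC b) / d z * d z)%C by (field; auto). rewrite H. ring. }
assert (Ez : forall z, in_disk z -> (z * e z)%C = (1 - p z * p z)%C).
{ intros z Hz. rewrite Ee, Epp by assumption.
  transitivity ((d z - n z) / d z)%C; [|field; auto].
  unfold Cdiv. rewrite Cmult_assoc. f_equal. unfold d, n. ring. }
assert (Dp : forall z, in_disk z ->
  cderiv p z (- (e z * e z / (1 + RtoC b)) / (2 * p z))).
{ intros z Hz.
  apply (cderiv_eq _ _ (((0 - 1) * d z - n z * (0 + RtoC b * 1)) / (d z * d z) / (2 * p z))).
  - f_equal. rewrite Ee by assumption.
    replace ((0 - 1) * d z - n z * (0 + RtoC b * 1))%C with (- (1 + RtoC b))%C
      by (unfold d, n; ring).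
    field. auto.
  - apply (cderiv_Csqrt_comp (fun w => n w / d w)%C); [auto|].
    apply (cderiv_div n d); [auto| |].
    + apply (cderiv_minus (fun _ => RtoC 1) (fun w => w)); [apply cderiv_const|apply cderiv_id].
    + apply (cderiv_plus (fun _ => RtoC 1)); [apply cderiv_const|].
      apply cderiv_scal, cderiv_id. }
assert (Epsi : forall z, psi_RL z = (1 + RtoC c * (1 - p z))%C).
{ intros z. unfold psi_RL. fold c b. fold (d z). fold (n z). fold (p z).
  replace (sqrt 2) with (c + 1) by (unfold c; ring). rewrite RtoC_plus. ring. }
set (be := sqrt b).
assert (Hbe : 0 < be) by (apply sqrt_lt_R0; lra).
assert (Ebe : (RtoC be * RtoC be)%C = RtoC b)
  by (rewrite <- RtoC_mult; f_equal; apply sqrt_sqrt; lra).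
assert (Nbe : RtoC be <> 0) by now apply RtoC_neq_0.
assert (Ei : (Ci * Ci)%C = (- (1))%C) by (apply Ceq_parts; simpl; ring).
set (X := fun z => (RtoC be * p z - Ci)%C). set (Y := fun z => (RtoC be * p z + Ci)%C).
assert (HX : forall z, in_disk z -> 0 < Re (X z)).
{ intros z Hz. unfold X. rewrite Re_minus, Re_RtoC_mult. specialize (Hp z Hz).
  simpl (Re Ci). assert (0 < be * Re (p z)) by (apply Rmult_lt_0_compat; assumption). lra. }
assert (HY : forall z, in_disk z -> 0 < Re (Y z)).
{ intros z Hz. unfold Y. rewrite Re_plus, Re_RtoC_mult. specialize (Hp z Hz).
  simpl (Re Ci). assert (0 < be * Re (p z)) by (apply Rmult_lt_0_compat; assumption). lra. }
assert (EXY : forall z, (X z * Y z)%C = e z).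
{ intros z. unfold X, Y, e. rewrite <- Ebe.
  transitivity (RtoC be * p z * (RtoC be * p z) - Ci * Ci)%C; [ring|]. rewrite Ei. ring. }
(* Partial-fraction coefficients: (1 + b p) / (1 + b p^2) = U / X + V / Y. *)
set (U := ((RtoC be - Ci) / 2)%C). set (V := ((RtoC be + Ci) / 2)%C).
assert (EUV : forall z, (U * Y z + V * X z)%C = (1 + RtoC b * p z)%C).
{ intros z. unfold U, V, X, Y. rewrite <- Ebe.
  transitivity (RtoC be * RtoC be * p z - Ci * Ci)%C; [field|]. rewrite Ei. ring. }
(* From [z = (1 - p^2) / (1 + b p^2)], [dQ/dp = - 2 c (1 + b) p / ((1 + p) (1 + b p^2))], split
   into partial fractions with [1 + b p^2 = (be p - i) (be p + i)].  Writing the factors this way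
   keeps all logarithms in the right half-plane. *)
set (L := fun z => (Clog (1 + p z) - (U / RtoC be * Clog (X z) + V / RtoC be * Clog (Y z)))%C).
set (Q := fun z => (2 * RtoC c * (L z - L 0))%C).
set (q := fun z => (RtoC c * e z / (1 + p z))%C).
apply (S_star_radius_of_extremal psi_RL Q q R0 (- R0) (- a)); auto.
(* Re psi = sqrt 2 - c Re p, and |p|^2 = |n| / |d| < 2 / (1 - b) = 2 / c^2. *)
- intros z Hz. rewrite Epsi, Re_plus, Re_RtoC_mult, Re_minus. simpl (Re 1).
  pose proof (Re_le_Cmod (p z)) as H. pose proof (Cmod_ge_0 (p z)).
  pose proof (Md z). pose proof (Mn z). pose proof (Mp z Hz) as M. unfold in_disk in Hz.
  pose proof (Cmod_ge_0 z).
  assert (b * Cmod z < b * 1) by (apply Rmult_lt_compat_l; lra).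
  assert (H5 : Cmod (p z) * Cmod (p z) * (1 - b) < 2).
  { apply Rle_lt_trans with (Cmod (p z) * Cmod (p z) * Cmod (d z)); [|lra].
    apply Rmult_le_compat_l; [apply Rle_0_sqr|lra]. }
  rewrite <- Ecb in H5.
  assert (c * Cmod (p z) < sqrt 2).
  { apply Rsqr_incrst_0; [unfold Rsqr; lra|apply Rmult_le_pos; lra|lra]. }
  assert (c * Re (p z) <= c * Cmod (p z)) by (apply Rmult_le_compat_l; lra).
  unfold c in *. lra.
- intros z Hz. eexists. apply (cderiv_ext (fun z => 1 + RtoC c * (1 - p z))%C); [now intros|].
  apply (cderiv_plus (fun _ => RtoC 1)); [apply cderiv_const|]. apply cderiv_scal.
  apply cderiv_minus; [apply cderiv_const|now apply Dp].
- intros z Hz HzR. fold a. rewrite Epsi.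
  replace (1 + RtoC c * (1 - p z) - 1)%C with (RtoC c * (z * (e z / (1 + p z))))%C.
  2: { transitivity (RtoC c * (z * e z / (1 + p z)))%C; [field; auto|].
       rewrite Ez by assumption. field. auto. }
  rewrite Cmod_RtoC_mult by lra. rewrite EaR, Cmod_mult, (Rmult_comm (Cmod z)), Rmult_assoc.
  apply Rmult_le_compat_l; [lra|]. apply Rmult_le_compat_r; [apply Cmod_ge_0|].
  (* |p|^2 is at most (1 + R0) / (1 - b R0), which is S^2. *)
  assert (HpS : Cmod (p z) * Cmod (p z) <= S * S).
  { apply Rmult_le_reg_r with (1 - b * R0); [assumption|]. rewrite <- ES.
    pose proof (Md z). pose proof (Mn z). pose proof (Mp z Hz). pose proof (Cmod_ge_0 z).
    apply Rle_trans with (Cmod (p z) * Cmod (p z) * Cmod (d z)); [|lra].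
    assert (b * Cmod z <= b * R0) by (apply Rmult_le_compat_l; lra).
    apply Rmult_le_compat_l; [apply Rle_0_sqr|lra]. }
  assert (HA : 0 <= A) by (apply Rdiv_le_0_compat; nra).
  assert (Hsq : Cmod (e z) <= A * Cmod (1 + p z)).
  { apply Cmod_le_of_sq; [apply Rmult_le_pos; [assumption|apply Cmod_ge_0]|].
    replace (A * Cmod (1 + p z) * (A * Cmod (1 + p z)))
      with (A * A * (Cmod (1 + p z) * Cmod (1 + p z))) by ring.
    rewrite Cmod_sq in *. pose proof (Hp z Hz) as Hx. unfold e.
    destruct (p z) as [x y]. simpl in *.
    pose proof (radius_RL_aux b S A x y Hb HS EA ltac:(lra) HpS) as P.
    eapply Rle_trans; [|eapply Rle_trans; [exact P|]]; right; ring. }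
  rewrite Cmod_div by auto.
  apply Rmult_le_reg_r with (Cmod (1 + p z)); [now apply Cmod_gt_0, N1|].
  unfold Rdiv. rewrite Rmult_assoc, Rinv_l, Rmult_1_r; [exact Hsq|].
  apply Rgt_not_eq, Cmod_gt_0, N1, Hz.
- unfold Q. ring.
- intros z Hz. unfold Q.
  set (dp := (- (e z * e z / (1 + RtoC b)) / (2 * p z))%C).
  assert (NX : X z <> 0) by now apply Re_gt_0_neq_0, HX.
  assert (NY : Y z <> 0) by now apply Re_gt_0_neq_0, HY.
  apply (cderiv_eq _ _ (2 * RtoC c * ((0 + dp) / (1 + p z)
    - (U / RtoC be * ((RtoC be * dp - 0) / X z) + V / RtoC be * ((RtoC be * dp + 0) / Y z)) - 0))).
  + transitivity (2 * RtoC c * dp * (/ (1 + p z) - (U * Y z + V * X z) / (X z * Y z)))%C;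
      [field; auto|].
    rewrite EUV, EXY. unfold q, dp.
    assert (Nez := Ne z Hz).
    transitivity (- (RtoC c * e z / (1 + p z))
      * ((e z - (1 + p z) * (1 + RtoC b * p z)) / (p z * (1 + RtoC b))))%C; [field; auto|].
    replace (e z - (1 + p z) * (1 + RtoC b * p z))%C with (- (p z * (1 + RtoC b)))%C
      by (unfold e; ring).
    field. auto.
  + apply cderiv_scal. apply cderiv_minus; [|apply cderiv_const].
    apply cderiv_minus; [|apply cderiv_plus; apply cderiv_scal].
    * apply (cderiv_Clog_comp (fun w => 1 + p w)%C).
      -- rewrite Re_plus. specialize (Hp z Hz). simpl (Re 1). lra.
      -- apply (cderiv_plus (fun _ => RtoC 1)); [apply cderiv_const|now apply Dp].
    * apply (cderiv_Clog_comp X); [auto|].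
      apply cderiv_minus; [|apply cderiv_const]. apply cderiv_scal. now apply Dp.
    * apply (cderiv_Clog_comp Y); [auto|].
      apply cderiv_plus; [|apply cderiv_const]. apply cderiv_scal. now apply Dp.
- intros z Hz. rewrite Epsi. unfold q.
  transitivity (RtoC c * (z * e z) / (1 + p z))%C; [field; auto|].
  rewrite Ez by assumption. field. auto.
- rewrite Rabs_Ropp, Rabs_pos_eq; lra.
- rewrite Epsi. unfold p, n, d.
  rewrite <- RtoC_mult, <- RtoC_plus, <- RtoC_minus, <- RtoC_div by lra.
  replace ((1 - - R0) / (1 + b * - R0)) with (S * S).
  + rewrite Csqrt_RtoC by nra. rewrite sqrt_square by lra.
    rewrite <- RtoC_minus, <- RtoC_mult. f_equal. f_equal. lra.
  + replace (1 - - R0) with (1 + R0) by ring. rewrite ES. field. lra.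
Qed.

(** * The stated decimals *)

Lemma approx6_between (x v : R) : v - 5 / 10 ^ 7 <= x <= v + 5 / 10 ^ 7 -> approx6 x v.
Proof. intros H. unfold approx6. apply Rabs_le. lra. Qed.

Lemma radius_L_approx : approx6 (arcsinh 1 * (2 - arcsinh 1)) 0.985928.
Proof.
pose proof arcsinh_1_bounds. apply approx6_between. split; nra.
Qed.

Lemma Rdiv_between (l u n d : R) : 0 < d -> l * d <= n <= u * d -> l <= n / d <= u.
Proof.
intros Hd [H1 H2]. split; apply Rmult_le_reg_r with d; auto;
  unfold Rdiv; rewrite Rmult_assoc, Rinv_l, Rmult_1_r; lra.
Qed.

Lemma radius_RL_approx : approx6
  ((2 + (1 + sqrt 2) * arcsinh 1) * arcsinh 1
   / (5 - 3 * sqrt 2 + (4 * (sqrt 2 - 1) + 2 * arcsinh 1) * arcsinh 1)) 0.964694.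
Proof.
pose proof arcsinh_1_bounds. pose proof sqrt_2_bounds.
set (a := arcsinh 1) in *. set (r := sqrt 2) in *.
(* Numerator and denominator are linear in a, r, a^2, r a and r a^2, so enclosing these products
   separately leaves only a linear comparison. *)
assert (0.776819398 <= a * a <= 0.776819402) by nra.
assert (1.246450478 <= r * a <= 1.246450483) by nra.
assert (1.098588526 <= r * (a * a) <= 1.098588536) by nra.
apply approx6_between, Rdiv_between; [nra|]. nra.
Qed.

Lemma radius_C_approx : approx6 (1 / 2 * (sqrt (2 * (2 + 3 * arcsinh 1)) - 2)) 0.523831.
Proof.
pose proof arcsinh_1_bounds.
pose proof (sqrt_pos (2 * (2 + 3 * arcsinh 1))).
pose proof (sqrt_sqrt (2 * (2 + 3 * arcsinh 1)) ltac:(lra)).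
apply approx6_between. split; nra.
Qed.

Lemma radius_e_approx : approx6 (ln (1 + arcsinh 1)) 0.632002.
Proof.
pose proof arcsinh_1_bounds.
apply approx6_between. split.
(* The two decimals enclose a / (2 + a), the solution x of (1 + x) / (1 - x) = 1 + a. *)
- apply (ln_lower_bound 6 0.3058865); [lra|lra|nra|]. simpl. lra.
- apply (ln_upper_bound 6 0.3058867); [lra|lra|lra|nra|]. simpl. lra.
Qed.

Lemma radius_Delta_approx :
  approx6 (arcsinh 1 * (2 + arcsinh 1) / (2 * (1 + arcsinh 1))) 0.674924.
Proof.
pose proof arcsinh_1_bounds. apply approx6_between, Rdiv_between; nra.
Qed.

Theorem theorem4p6 :
  (is_class_radius S_star_rho S_star_L
     (arcsinh 1 * (2 - arcsinh 1))
   /\ approx6 (arcsinh 1 * (2 - arcsinh 1)) 0.985928)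
  /\
  (is_class_radius S_star_rho S_star_RL
     ((2 + (1 + sqrt 2) * arcsinh 1) * arcsinh 1
      / (5 - 3 * sqrt 2 + (4 * (sqrt 2 - 1) + 2 * arcsinh 1) * arcsinh 1))
   /\ approx6
     ((2 + (1 + sqrt 2) * arcsinh 1) * arcsinh 1
      / (5 - 3 * sqrt 2 + (4 * (sqrt 2 - 1) + 2 * arcsinh 1) * arcsinh 1)) 0.964694)
  /\
  (is_class_radius S_star_rho S_star_C
     (1 / 2 * (sqrt (2 * (2 + 3 * arcsinh 1)) - 2))
   /\ approx6 (1 / 2 * (sqrt (2 * (2 + 3 * arcsinh 1)) - 2)) 0.523831)
  /\
  (is_class_radius S_star_rho S_star_e
     (ln (1 + arcsinh 1))
   /\ approx6 (ln (1 + arcsinh 1)) 0.632002)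
  /\
  (is_class_radius S_star_rho Delta_star
     (arcsinh 1 * (2 + arcsinh 1) / (2 * (1 + arcsinh 1)))
   /\ approx6 (arcsinh 1 * (2 + arcsinh 1) / (2 * (1 + arcsinh 1))) 0.674924)
  /\
  (forall alpha : R, 0 <= alpha <= 1 ->
     is_class_radius S_star_rho (BS_star alpha)
       (if Req_EM_T alpha 0 then arcsinh 1
        else (- 1 + sqrt (1 + alpha * (2 * arcsinh 1) ^ 2))
             / (2 * alpha * arcsinh 1))).
Proof.
repeat match goal with |- _ /\ _ => split end.
- exact radius_L.
- exact radius_L_approx.
- exact radius_RL.
- exact radius_RL_approx.
- exact radius_C.
- exact radius_C_approx.
- exact radius_e.
- exact radius_e_approx.
- exact radius_Delta.
- exact radius_Delta_approx.
- exact radius_BS.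
Qed.
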